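(* Let $\mathcal X,\mathcal Y$ be real separable Hilbert spaces with $\mathcal Y\neq\{0\}$, let $1\le p<\infty$, $B,L>0$, $\sigma>0$, $m\in\mathbb N$, and let $\mu$ be a probability measure on $\mathcal X$ satisfying conditions (i), (ii), (iii-L), (iii-U) of the context. Suppose either (a) the noise is Hilbert-valued Gaussian noise with covariance operator $\Upsilon$, and $\mathcal F=\mathcal F_{B,L}$; or (b) the noise is Gaussian white noise on $\mathcal Y$, and $\mathcal F=\mathcal F^t_{B,L}$ for some $t>0$. Then there is a constant $c>0$, depending only on $\Upsilon$ in case (a) and universal in case (b), such that $$\mathcal M_m(\mathcal F;L^p_\mu)\ \gtrsim\ \frac{L}{\sqrt{\sum_{j=1}^d 1/\lambda_j}}\left(\frac{\iota}{p+1}\right)^{d/p}\min\left\{\frac a8,\ \left(\frac{L^2 m}{c\,a^d\sigma^2\sum_{j=1}^d 1/\lambda_j}\right)^{-\frac1{2+d}}\right\}$$ for all $d\in\mathbb N$ (with $d\le\dim\mathcal X$) satisfying $$\frac{aL}{8\sqrt{\sum_{i=1}^d 1/\lambda_i}}\le B,$$ where $\mathcal M_m(\mathcal F;L^p_\mu)$ is either the fixed-design or the random-design minimax risk, and $\gtrsim$ holds with a universal constant.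
   Context: Conditions on $\mu$ (a Borel probability measure on $\mathcal X$; $\mathcal X$ may be finite- or infinite-dimensional): (i) $\mu$ has mean zero and $\int_{\mathcal X}\|X\|_{\mathcal X}^2\,d\mu(X)<\infty$. (ii) Let $\lambda_1\ge\lambda_2\ge\cdots>0$ and $\{\phi_i\}_i\subset\mathcal X$ be the eigenvalues and an orthonormal basis of eigenvectors of the covariance operator of $\mu$. The real random variables $\xi_i=\langle X,\phi_i\rangle_{\mathcal X}/\sqrt{\lambda_i}$, $X\sim\mu$, are independent. (iii-L) Each $\xi_i$ has a density $\nu_i$ with respect to Lebesgue measure, and there are constants $a,b>0$ (independent of $i$) with $\nu_i(x)\ge b$ for all $|x|\le a$ and all $i$. Put $\iota=2ab\le1$. (This is the condition required for lower bounds.) (iii-U) With $p'=\max\{p,2\}$, $\sup_i(\mathbb E|\xi_i|^{p'})^{1/p'}<\infty$. (This is the condition required for upper bounds.) Observations: $Y_i=F(X_i)+\sigma E_i$, $i=1,\dots,m$, with $E_1,\dots,E_m$ i.i.d. Hilbert-valued Gaussian noise: $E_i$ is a mean-zero Gaussian random element of $\mathcal Y$ with covariance operator $\Upsilon$, $\mathrm{Tr}(\Upsilon)=1$. Gaussian white noise: $Y_i$ is observed through $\langle Y_i,y\rangle=\langle F(X_i),y\rangle_{\mathcal Y}+\sigma\langle E_i,y\rangle$, $y\in\mathcal Y$, where $y\mapsto\langle E_i,y\rangle$ is a centered Gaussian linear process with $\mathbb E[\langle E_i,y\rangle\langle E_i,y'\rangle]=\langle y,y'\rangle_{\mathcal Y}$.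 Classes: $\mathcal F_{B,L}$ is the set of $F:\mathcal X\to\mathcal Y$ with $\|F(X)\|_{\mathcal Y}\le B$ and $\|F(X)-F(X')\|_{\mathcal Y}\le L\|X-X'\|_{\mathcal X}$ for all $X,X'\in\mathcal X$. Given an orthonormal basis $\{\psi_i\}_i$ of $\mathcal Y$ and the weights $w_i=i$, set $\|Y\|_{\mathcal Y^t}^2=\sum_i w_i^{2t}|\langle Y,\psi_i\rangle_{\mathcal Y}|^2$; $\mathcal F^t_{B,L}$ is the set of $F:\mathcal X\to\mathcal Y$ with $\|F(X)\|_{\mathcal Y^t}\le B$ and $\|F(X)-F(X')\|_{\mathcal Y}\le L\|X-X'\|_{\mathcal X}$ for all $X,X'\in\mathcal X$. Norm: $\|F\|_{L^p_\mu(\mathcal X;\mathcal Y)}=(\int_{\mathcal X}\|F(X)\|_{\mathcal Y}^p\,d\mu(X))^{1/p}$. Minimax risks: an estimator $\widehat F$ is a mapping from the data to $L^p_\mu(\mathcal X;\mathcal Y)$. Fixed design: $\mathcal M_m(\mathcal F;L^p_\mu)=\inf_{\mathcal D}\inf_{\widehat F}\sup_{F\in\mathcal F}\mathbb E\|F-\widehat F\|_{L^p_\mu(\mathcal X;\mathcal Y)}$, with infimum over designs $\mathcal D=\{X_1,\dots,X_m\}\subset\mathcal X$ and expectation over the $E_i$. Random design: $\mathcal M_m(\mathcal F;L^p_\mu)=\inf_\nu\inf_{\widehat F}\sup_{F\in\mathcal F}\mathbb E\|F-\widehat F\|_{L^p_\mu(\mathcal X;\mathcal Y)}$, with infimum over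 probability measures $\nu$ on $\mathcal X$, $X_1,\dots,X_m$ i.i.d. from $\nu$ independent of the $E_i$, and expectation over the $X_i$ and $E_i$. *)

(* Defs.v *)
From HB Require Import structures.
From mathcomp Require Export all_boot all_order all_algebra.
From mathcomp Require Export finmap.
From mathcomp Require Export all_classical all_reals all_analysis.

Set Implicit Arguments.
Unset Strict Implicit.
Unset Printing Implicit Defensive.

Export Order.TTheory GRing.Theory Num.Theory.
Export numFieldNormedType.Exports.

Global Open Scope classical_set_scope.
Global Open Scope ring_scope.

HB.mixin Record CompleteNormedModule_isHilbert (R : realType) (H : Type)
    & CompleteNormedModule R H := {
  inner : H -> H -> R ;
  innerC : forall x y, inner x y = inner y x ;
  innerDl : forall x y z, inner (x + y) z = inner x z + inner y z ;
  innerZl : forall (k : R) x y, inner (k *: x) y = k * inner x y ;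
  inner_norm : forall x, inner x x = `|x| ^+ 2
}.

#[short(type="hilbertType")]
HB.structure Definition Hilbert (R : realType) :=
  {H of CompleteNormedModule R H & CompleteNormedModule_isHilbert R H}.

Definition separable (T : topologicalType) :=
  exists D : set T, countable D /\ dense D.

(** Orthonormal bases of a separable space are indexed by an initial segment of
    nat: [Some n] stands for the indices 0, ..., n.-1 and [None] for all of nat,
    so that a basis indexed by [N] makes [N] the Hilbert dimension of the
    space. Index i here is index i + 1 in 1-based notation. *)
Definition in_dim (N : option nat) (i : nat) : bool :=
  if N is Some n then (i < n)%N else true.

Definition le_dim (d : nat) (N : option nat) : bool :=
  if N is Some n then (d <= n)%N else true.

Record orthonormal_basis (R : realType) (H : hilbertType R)
    (N : option nat) (e : nat -> H) : Prop := {
  basis_orthonormal : forall i j, in_dim N i -> in_dim N j ->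
    inner (e i) (e j) = (i == j)%:R ;
  basis_expansion : forall x,
    (\sum_(0 <= i < n | in_dim N i) inner x (e i) *: e i) @[n --> \oo] --> x
}.

Notation borel T := (g_sigma_algebraType (@open T)).

(** Weak (Pettis) mean and covariance; for a measure with finite second moment
    they agree with the Bochner ones. *)
Definition has_mean (R : realType) (H : hilbertType R)
    (mu : probability (borel H) R) (m : H) : Prop :=
  forall x : H, ('E_mu[fun u : H => inner u x] = (inner m x)%:E)%E.

Definition covariance_operator (R : realType) (H : hilbertType R)
    (mu : probability (borel H) R) (C : {linear H -> H}) : Prop :=
  forall x y : H,
    covariance mu (fun u : H => inner u x) (fun u : H => inner u y)
    = (inner (C x) y)%:E.

Definition independent (R : realType) d (T : measurableType d)
    (P : probability T R) (D : set nat) (xi : nat -> T -> R) : Prop :=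
  forall (J : {fset nat}) (A : nat -> set R),
    [set` J] `<=` D -> (forall i, measurable (A i)) ->
    P (\bigcap_(i in [set` J]) (xi i @^-1` A i))
    = (\prod_(i <- J) P (xi i @^-1` A i))%E.

Definition has_density (R : realType) d (T : measurableType d)
    (P : probability T R) (X : T -> R) (f : R -> R) : Prop :=
  [/\ measurable_fun setT f, forall x, 0 <= f x &
      forall A, measurable A ->
        P (X @^-1` A) = (\int[lebesgue_measure]_(x in A) (f x)%:E)%E].

Definition kl_coord (R : realType) (H : hilbertType R)
    (lam : nat -> R) (phi : nat -> H) (i : nat) (x : H) : R :=
  inner x (phi i) / Num.sqrt (lam i).

Record design_measure (R : realType) (X : hilbertType R) (p a b : R)
    (N : option nat) (lam : nat -> R) (phi : nat -> X)
    (mu : probability (borel X) R) : Prop := {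
  design_mean0 : has_mean mu 0 ;
  design_moment2 : (\int[mu]_x (`|x : X| ^+ 2)%:E < +oo)%E ;
  design_lam_gt0 : forall i, in_dim N i -> 0 < lam i ;
  design_lam_mono : forall i j, in_dim N j -> (i <= j)%N -> lam j <= lam i ;
  design_basis : orthonormal_basis N phi ;
  design_eigen : exists2 C : {linear X -> X}, covariance_operator mu C &
    forall i, in_dim N i -> C (phi i) = lam i *: phi i ;
  design_independent :
    independent mu [set i | in_dim N i] (kl_coord lam phi) ;
  design_a_gt0 : 0 < a ;
  design_b_gt0 : 0 < b ;
  design_density : forall i, in_dim N i -> exists2 nu : R -> R,
    has_density mu (kl_coord lam phi i) nu &
    forall x, `|x| <= a -> b <= nu x ;
  design_moments : (ereal_sup
    [set ('N[mu]_((Num.max p 2)%:E)[EFin \o kl_coord lam phi i])%E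
      | i in [set i | in_dim N i]] < +oo)%E
}.

(** The library's [normal_prob 0 0] is a uniform law, not a point mass. *)
Definition centered_gaussian (R : realType) d (T : measurableType d)
    (P : probability T R) (X : T -> R) : Prop :=
  measurable_fun setT X /\
  exists2 s : R, 0 <= s & forall A : set R, measurable A ->
    P (X @^-1` A) = if s == 0 then \d_(0 : R) A else normal_prob 0 s A.

(** The trace of a positive operator does not depend on the basis. *)
Definition trace1_covariance (R : realType) (Y : hilbertType R)
    (Ups : {linear Y -> Y}) : Prop :=
  [/\ continuous Ups,
      forall y z, inner (Ups y) z = inner y (Ups z),
      forall y, 0 <= inner (Ups y) y &
      exists N e, orthonormal_basis N e /\
        \esum_(i in [set i | in_dim N i]) (inner (Ups (e i)) (e i))%:E = 1%E].

Definition hilbert_noise (R : realType) (Y : hilbertType R)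
    (Ups : {linear Y -> Y}) (gamma : probability (borel Y) R) : Prop :=
  (forall y : Y, centered_gaussian gamma (fun e : Y => inner e y)) /\
  covariance_operator gamma Ups.

(** A realization of a process indexed by Y is a function Y -> R, measured
    through its values at points of Y. *)
Definition cylinders (R : realType) (Y : Type) : set (set (Y -> R)) :=
  [set A | exists y : Y, exists2 B : set R, measurable B &
     A = (fun w => w y) @^-1` B].

Notation process R Y := (g_sigma_algebraType (@cylinders R Y)).

Record white_noise (R : realType) (Y : hilbertType R)
    (gamma : probability (process R Y) R) : Prop := {
  white_linear : forall (k : R) (y z : Y),
    {ae gamma, forall w : Y -> R, w (k *: y + z) = k * w y + w z} ;
  white_gaussian : forall (n : nat) (k : 'I_n -> R) (y : 'I_n -> Y),
    centered_gaussian gamma (fun w : Y -> R => \sum_i k i * w (y i)) ;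
  white_covariance : forall y z : Y,
    ('E_gamma[fun w : Y -> R => (w y * w z)%R] = (inner y z)%:E)%E
}.

Definition observe_hilbert (R : realType) (Y : hilbertType R) (sigma : R)
    (y : Y) (e : borel Y) : borel Y := y + sigma *: (e : Y).

Definition observe_white (R : realType) (Y : hilbertType R) (sigma : R)
    (y : Y) (w : process R Y) : process R Y :=
  fun z : Y => inner y z + sigma * w z.

Section iid.
Context {d} {T : measurableType d} {R : realType}.

Definition tuple_cons n (z : T * n.-tuple T) : n.+1.-tuple T :=
  [the n.+1.-tuple T of z.1 :: z.2].

Lemma measurable_tuple_cons n : measurable_fun setT (@tuple_cons n).
Proof. exact: measurable_cons. Qed.

HB.instance Definition _ n :=
  isMeasurableFun.Build _ _ _ _ (@tuple_cons n) (@measurable_tuple_cons n).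

Fixpoint iid_law (P : probability T R) (n : nat) : probability (n.-tuple T) R :=
  if n is n'.+1 then distribution (P \x iid_law P n')%E (@tuple_cons n')
  else \d_([tuple] : 0.-tuple T).

End iid.

Definition class_BL (R : realType) (X Y : hilbertType R) (B L : R) :
    set (X -> Y) :=
  [set F | (forall x, `|F x| <= B) /\
           (forall x x', `|F x - F x'| <= L * `|x - x'|)].

Definition smooth_norm (R : realType) (Y : hilbertType R)
    (N : option nat) (psi : nat -> Y) (t : R) (y : Y) : \bar R :=
  ((\esum_(i in [set i | in_dim N i])
     ((i.+1%:R `^ (2 * t)) * `|inner y (psi i)| ^+ 2)%:E) `^ 2^-1)%E.

Definition class_tBL (R : realType) (X Y : hilbertType R)
    (N : option nat) (psi : nat -> Y) (t B L : R) : set (X -> Y) :=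
  [set F | (forall x, (smooth_norm N psi t (F x) <= B%:E)%E) /\
           (forall x x', `|F x - F x'| <= L * `|x - x'|)].

Section risk.
Context {R : realType} {X Y : hilbertType R}.
Variables (mu : probability (borel X) R) (p : R).

Definition Lp_norm (F : X -> Y) : \bar R := ('N[mu]_(p%:E)[(fun x => `|F x|%:E)])%E.

Definition Lp_space : set (X -> Y) :=
  [set F | measurable_fun setT (F : borel X -> borel Y) /\
           (Lp_norm F < +oo)%E].

(** Open sets for the L^p pseudometric, on functions rather than on their
    classes modulo equality almost everywhere. *)
Definition Lp_open (U : set (X -> Y)) : Prop :=
  forall F, Lp_space F -> U F -> exists2 eps : R, 0 < eps &
    forall G, Lp_space G -> (Lp_norm (fun x => (G x - F x)%R) < eps%:E)%E -> U G.

(** Borel measurability into L^p makes the expected loss a genuine integral;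
    the library's integral of a nonmeasurable function is a lower integral. *)
Definition estimator d (D : measurableType d) : set (D -> X -> Y) :=
  [set Fhat | (forall z, Lp_space (Fhat z)) /\
     forall U, Lp_open U -> measurable (Fhat @^-1` U)].

Variables (d : measure_display) (T : measurableType d).
Variables (gamma : probability T R) (obs : Y -> T -> T) (m : nat).

(** [gamma] is the law of one noise variable, and [obs y e] is the observation
    of the value y under the noise realization e. *)
Definition minimax_fixed (Fcl : set (X -> Y)) : \bar R :=
  ereal_inf [set
    ereal_inf [set
      ereal_sup [set
        (\int[iid_law gamma m]_e Lp_norm (fun x => (F x -
           Fhat [tuple obs (F (tnth xs i)) (tnth e i) | i < m] x)%R))%E
      | F in Fcl]
    | Fhat in @estimator _ (m.-tuple T)]
  | xs in [set: m.-tuple X]].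

Definition minimax_random (Fcl : set (X -> Y)) : \bar R :=
  ereal_inf [set
    ereal_inf [set
      ereal_sup [set
        (\int[iid_law nu m \x iid_law gamma m]_z Lp_norm (fun x => (F x -
           Fhat [tuple (tnth z.1 i, obs (F (tnth z.1 i)) (tnth z.2 i)) | i < m]
                x)%R))%E
      | F in Fcl]
    | Fhat in @estimator _ (m.-tuple (borel X * T))]
  | nu in [set: probability (borel X) R]].

End risk.

Definition sum_inv (R : realType) (lam : nat -> R) (d : nat) : R :=
  \sum_(0 <= j < d) (lam j)^-1.

(** Here iota = 2 * a * b. *)
Definition lower_rate (R : realType) (c p L sigma a b : R) (lam : nat -> R)
    (m d : nat) : R :=
  L / Num.sqrt (sum_inv lam d)
  * ((2 * a * b) / (p + 1)) `^ (d%:R / p)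
  * Num.min (a / 8)
      ((L ^+ 2 * m%:R / (c * a ^+ d * sigma ^+ 2 * sum_inv lam d))
        `^ (- (2 + d%:R)^-1)).

(* Main.v *)
From HB Require Import structures.
Require Import Defs.
From mathcomp Require Import ring lra measurable_realfun.

(** The lower bound is Assouad's. In the Karhunen-Loeve coordinates
    xi_1, ..., xi_d split the cube [-a, a]^d into n^d cells of radius r = a / n,
    place on each cell a bump of height h ~ L r / sqrt (sum_j 1 / lambda_j), and
    give the bumps arbitrary signs along a fixed unit vector y of Y. The bumps
    have disjoint supports, so all 2^(n^d) sign patterns give maps in the class.
    Independence and the density bound give each cell a core of mass at least
    (2 b r / (p + 1))^d on which its bump exceeds h / 2, so the L^p distance of
    two patterns is bounded below by their Hamming distance. Flipping one sign
    changes only the observations at design points of that cell; as the cells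
    are disjoint, the total information is at most of order
    m h^2 / sigma^2, whatever the design, and r^(d + 2) ~ a^d sigma^2
    (sum_j 1 / lambda_j) / (L^2 m) makes it smaller than the number of cells.

    Two observation laws are compared through the second moment of their
    likelihood ratio, without a Cameron-Martin formula: if V is one Gaussian
    coordinate of the noise e and u the direction with Cov(f, V) = f(u) Var V
    for all linear f, then e - V(e) u is independent of V(e), so that a shift
    of e along u is a shift of a one-dimensional Gaussian variable. That
    e - V(e) u + v u, with v an independent copy of V, has the law of e is a
    consequence of the Cramer-Wold theorem. In Hilbert space u is proportional
    to Upsilon w if V = <e, w>; for white noise it is y itself. *)

(** Total variation or entropy bounds would call for densities of the observation laws. The
    inequality in [shift_property] calls for none: it speaks of nonnegative test functions only,
    survives measurable maps and multiplies over independent observations. For an indicator it reads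
    P(A)^2 <= e^x P'(A), enough to bound the error of a test between two signals.

    The Bayes risk is bounded as a sum over sign patterns, for each realized design. Unlike a
    supremum, such a sum commutes with the integral over random designs, so one estimate serves both
    risks.

    The variance M of the standard normal law is kept as a symbol and absorbed in the constants. If
    k / sigma^2 is the constant of [shift_property], then c = 1 / (3 k), the 3 coming from the
    requirement that the information be at most n^d / 3. The universal factor 1/32 is 1/2 from the
    height h = L r / (2 sqrt (sum_j 1 / lambda_j)), 1/8 from Assouad's lemma and 1/2 from rounding
    the number of cells per axis to an integer. *)

Import HBNNSimple.
Set SsrOldRewriteGoalsOrder.
Set Implicit Arguments.
Unset Strict Implicit.
Unset Printing Implicit Defensive.

(** * Centered Gaussian variables *)

Section density.
Local Open Scope ereal_scope.
Context d (T : measurableType d) (R : realType).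
Variables (mu nu : {measure set T -> \bar R}) (w : T -> R).
Hypotheses (mw : measurable_fun setT w) (w0 : forall x, (0 <= w x)%R).
Hypothesis nuE :
  forall A, measurable A -> nu A = \int[mu]_(x in A) (w x)%:E.

(** The identity on sets extends to simple functions by linearity and to [g] by monotone convergence
    on both sides, the weight [w] being nonnegative. *)
Lemma ge0_integral_density (g : T -> \bar R) :
  measurable_fun setT g -> (forall x, 0 <= g x) ->
  \int[nu]_x g x = \int[mu]_x (g x * (w x)%:E).
Proof.
move=> mg g0; pose f_ := nnsfun_approx measurableT mg.
transitivity (limn (fun n => \int[nu]_x (f_ n x)%:E)).
  rewrite -monotone_convergence//.
  - apply: eq_integral => y _; apply/esym/cvg_lim => //.
    by apply: cvg_nnsfun_approx.
  - by move=> n; exact/measurable_EFinP/measurable_funP.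
  - by move=> n y _; rewrite lee_fin.
  - by move=> y _ m n mn; rewrite lee_fin; exact/lefP/nd_nnsfun_approx.
have -> : (fun n => \int[nu]_x (f_ n x)%:E) =
    (fun n => \int[mu]_x ((f_ n x)%:E * (w x)%:E)).
  apply/funext => n.
  under eq_integral do rewrite fimfunE -fsumEFin//.
  rewrite ge0_integral_fsum//; last 2 first.
  - by move=> y; exact/measurable_EFinP/measurable_funM.
  - by move=> y x _; rewrite nnfun_muleindic_ge0.
  transitivity (\sum_(k \in range (f_ n))
      \int[mu]_x ((k * \1_(f_ n @^-1` [set k]) x)%:E * (w x)%:E)).
    apply: eq_fsbigr => r; rewrite inE => -[t _ fr].
    have r0 : (0 <= r)%R by rewrite -fr.
    rewrite integralZl_indic_nnsfun// integral_indic//= setIT nuE//.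
    under [RHS]eq_integral do rewrite EFinM -muleA.
    rewrite ge0_integralZl//; last 2 first.
    - by apply: emeasurable_funM; exact/measurable_EFinP.
    - by move=> x _; rewrite mule_ge0// lee_fin.
    congr (_ * _); rewrite [LHS]integral_mkcond.
    apply: eq_integral => x _; rewrite patchE indicE.
    by case: ifP => _; rewrite ?mul1e ?mul0e.
  rewrite -ge0_integral_fsum//; last 2 first.
  - move=> r; apply: emeasurable_funM; apply/measurable_EFinP => //.
    exact: measurable_funM.
  - move=> r x _; apply: mule_ge0; last by rewrite lee_fin.
    by rewrite EFinM nnfun_muleindic_ge0.
  apply: eq_integral => x _.
  rewrite [in RHS]fimfunE -fsumEFin// ge0_mule_fsuml// => r.
  exact: nnfun_muleindic_ge0.
rewrite -monotone_convergence//.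
- apply: eq_integral => y _; apply/cvg_lim => //.
  by apply: cvgeZr => //; exact: cvg_nnsfun_approx.
- move=> n; apply: emeasurable_funM; apply/measurable_EFinP => //.
- by move=> n y _; rewrite mule_ge0// lee_fin.
- move=> y _ m n mn; rewrite lee_wpmul2r ?lee_fin//.
  exact/lefP/nd_nnsfun_approx.
Qed.
End density.

Section cauchy_schwarz.
Local Open Scope ereal_scope.
Context d (T : measurableType d) (R : realType).
Variable mu : {measure set T -> \bar R}.

(** Cauchy-Schwarz for an [f] that may take the value +oo: 2 f w <= l w^2 + f^2 / l is integrated
    for every l > 0, and l is optimized once infinite integrals are set aside. *)
Lemma integral_mul_sqr_le (f : T -> \bar R) (w : T -> R) (chi : R) :
  measurable_fun setT f -> (forall x, 0 <= f x) ->
  measurable_fun setT w -> (forall x, (0 <= w x)%R) -> (0 < chi)%R ->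
  \int[mu]_x ((w x * w x)%R)%:E <= chi%:E ->
  (\int[mu]_x (f x * (w x)%:E)) * (\int[mu]_x (f x * (w x)%:E))
    <= chi%:E * \int[mu]_x (f x * f x).
Proof.
move=> mf f0 mw w0 chi0 wchi.
have ff0 x : 0 <= f x * f x by rewrite mule_ge0.
have fw0 x : 0 <= f x * (w x)%:E by rewrite mule_ge0// lee_fin.
have mff : measurable_fun setT (fun x => f x * f x) by exact: emeasurable_funM.
have mfw : measurable_fun setT (fun x => f x * (w x)%:E).
  by apply: emeasurable_funM => //; exact/measurable_EFinP.
have key (l : R) : (0 < l)%R -> 2%:E * \int[mu]_x (f x * (w x)%:E) <=
    (l * chi)%:E + (l^-1)%:E * \int[mu]_x (f x * f x).
  move=> l0; apply: (@le_trans _ _ (l%:E * \int[mu]_x ((w x * w x)%R)%:E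
      + (l^-1)%:E * \int[mu]_x (f x * f x))); last first.
    by rewrite EFinM leeD2r// lee_wpmul2l// lee_fin ltW.
  have mww : measurable_fun setT (fun x => ((w x * w x)%R)%:E).
    by apply/measurable_EFinP; exact: measurable_funM.
  have l0E : 0 <= l%:E by rewrite lee_fin ltW.
  have l1 : 0 <= (l^-1)%:E by rewrite lee_fin invr_ge0 ltW.
  rewrite -!ge0_integralZl//; last by move=> x _; rewrite lee_fin mulr_ge0.
  rewrite -ge0_integralD//; last 4 first.
  - by move=> x _; rewrite mule_ge0// lee_fin mulr_ge0.
  - exact: measurable_funeM.
  - by move=> x _; rewrite mule_ge0.
  - exact: measurable_funeM.
  apply: ge0_le_integral => //.
  - by move=> x _; rewrite mule_ge0.
  - exact: measurable_funeM.
  - by apply: emeasurable_funD; exact: measurable_funeM.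
  move=> x _; have := f0 x; have := w0 x; case: (f x) => // [y|]; last first.
    move=> wx _; rewrite mulyy gt0_muley ?lte_fin ?invr_gt0//.
    by rewrite addey ?leey.
  rewrite -!EFinM -EFinD !lee_fin => wx y0.
  rewrite -subr_ge0.
  have -> : (l * (w x * w x) + l^-1 * (y * y) - 2 * (y * w x) =
     l^-1 * (l * w x - y) ^+ 2)%R by field; rewrite gt_eqF.
  by rewrite mulr_ge0 ?sqr_ge0.
have [/eqP Boo|] := boolP (\int[mu]_x (f x * f x) == +oo).
  by rewrite Boo gt0_muley ?lte_fin// leey.
have I0 : 0 <= \int[mu]_x (f x * (w x)%:E) by exact: integral_ge0.
have J0 : 0 <= \int[mu]_x (f x * f x) by exact: integral_ge0.
move: key I0 J0; case: (\int[mu]_x (f x * f x)) => // B key I0 B0 _.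
move: key I0; case: (\int[mu]_x (f x * (w x)%:E)) => // [x key|key _]; last first.
  by have := key 1%R ltr01; rewrite gt0_muley ?lte_fin// leye_eq.
rewrite lee_fin le_eqVlt => /predU1P[<-|x0].
  by rewrite mule0 mule_ge0// lee_fin ltW.
(* With l = x / chi the first term on the right is x, half of the left-hand side 2 x. *)
have := key (x / chi)%R (divr_gt0 x0 chi0).
rewrite -!EFinM -EFinD !lee_fin divfK ?gt_eqF// invf_div => h.
have : (x <= chi / x * B)%R by lra.
by rewrite mulrAC ler_pdivlMr.
Qed.

Lemma integral_sqr_le (f : T -> \bar R) :
  mu setT = 1 -> measurable_fun setT f -> (forall x, 0 <= f x) ->
  (\int[mu]_x f x) * (\int[mu]_x f x) <= \int[mu]_x (f x * f x).
Proof.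
move=> mu1 mf f0; have := @integral_mul_sqr_le f (cst 1%R) 1%R mf f0.
rewrite mul1e.
rewrite (_ : \int[mu]_x (f x * _) = \int[mu]_x f x); last first.
  by apply: eq_integral => x _; rewrite mule1.
by apply => //=; rewrite mulr1 integral_cst// mul1e mu1.
Qed.

End cauchy_schwarz.

Section normal.
Local Open Scope ereal_scope.
Context {R : realType}.
Local Notation leb := (@lebesgue_measure R).

Lemma ge0_integral_lebesgueDr (a : R) (f : R -> \bar R) :
  measurable_fun setT f -> (forall x, 0 <= f x) ->
  \int[leb]_x f (x + a)%R = \int[leb]_x f x.
Proof.
move=> mf f0; pose sh : R -> measurableTypeR R := fun x => (x + a)%R.
have msh : measurable_fun setT sh by exact: measurable_funD.
transitivity (\int[pushforward leb sh]_x f x).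
  by rewrite ge0_integral_pushforward.
apply: eq_measure_integral => A mA _.
apply/esym/lebesgue_measure_unique => //= _ [[x y]] _ <-.
rewrite /pushforward (_ : sh @^-1` _ = `](x - a)%R, (y - a)%R]%classic).
  rewrite !lebesgue_measure_itv/= !lte_fin ltrD2r.
  by case: ifP => // _; rewrite -!EFinB; congr EFin; lra.
by apply/seteqP; split => z /=; rewrite !in_itv/= ltrBlDr lerBrDr.
Qed.

Lemma ge0_integral_normal_prob (m s : R) (g : R -> \bar R) :
  measurable_fun setT g -> (forall x, 0 <= g x) ->
  \int[normal_prob m s]_x g x = \int[leb]_x (g x * (normal_pdf m s x)%:E).
Proof.
move=> mg g0; apply: ge0_integral_density => //.
- exact: measurable_normal_pdf.
- by move=> x; rewrite normal_pdf_ge0.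
Qed.

Lemma normal_pdfD (m s a x : R) :
  s != 0%R -> normal_pdf m s (x + a) = normal_pdf (m - a) s x.
Proof.
move=> s0; by rewrite !normal_pdfE// /normal_fun (_ : x + a - m = x - (m - a))%R//;
  rewrite opprB addrA.
Qed.

(** The weight [w] is the density of the normal law of mean a with respect to that of mean 0. Its
    second moment is exp (a^2 / s^2), since w^2 times the density of mean 0 is this factor times the
    density of mean 2 a. *)
Lemma normal_shift_sqr_le (s a : R) (g : R -> \bar R) : s != 0%R ->
  measurable_fun setT g -> (forall x, 0 <= g x) ->
  (\int[normal_prob 0 s]_x g (x + a)%R) * (\int[normal_prob 0 s]_x g (x + a)%R)
  <= (expR (a ^+ 2 / s ^+ 2))%:E * \int[normal_prob 0 s]_x (g x * g x).
Proof.
move=> s0 mg g0; pose w x : R := expR ((2 * x * a - a ^+ 2) / (s ^+ 2 *+ 2)).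
have mw : measurable_fun setT w.
  apply: measurableT_comp => //; apply: measurable_funM => //.
  by apply: measurable_funB => //; apply: measurable_funM => //;
    exact: measurable_funM.
have mp (m : R) : measurable_fun setT (fun x => (normal_pdf m s x)%:E).
  by apply/measurable_EFinP; exact: measurable_normal_pdf.
have w0 x : (0 <= w x)%R by rewrite expR_ge0.
have mgw : measurable_fun setT (fun x => g x * (w x)%:E).
  by apply: emeasurable_funM => //; exact/measurable_EFinP.
have gw0 x : 0 <= g x * (w x)%:E by rewrite mule_ge0// lee_fin.
have -> : \int[normal_prob 0 s]_x g (x + a)%R =
    \int[normal_prob 0 s]_x (g x * (w x)%:E).
  rewrite !ge0_integral_normal_prob//; last first.
    by apply: measurableT_comp => //; exact: measurable_funD.
  transitivity (\int[leb]_x ((fun y => g y * (normal_pdf a s y)%:E) (x + a)%R)).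
    by apply: eq_integral => x _ /=; rewrite normal_pdfD// subrr.
  rewrite (@ge0_integral_lebesgueDr a
    (fun y => g y * (normal_pdf a s y)%:E)); last 2 first.
  - exact: emeasurable_funM.
  - by move=> x; rewrite mule_ge0// lee_fin normal_pdf_ge0.
  apply: eq_integral => x _; rewrite -muleA -EFinM; congr (_ * _%:E).
  rewrite !normal_pdfE// mulrCA; congr (_ * _)%R; rewrite /normal_fun -expRD.
  by congr expR; field.
apply: integral_mul_sqr_le => //; first exact: expR_gt0.
rewrite ge0_integral_normal_prob//; last 2 first.
- by apply/measurable_EFinP; exact: measurable_funM.
- by move=> x; rewrite lee_fin mulr_ge0.
suff -> : \int[leb]_x ((w x * w x)%:E * (normal_pdf 0 s x)%:E) =
    (expR (a ^+ 2 / s ^+ 2))%:E * \int[leb]_x (normal_pdf (2 * a) s x)%:E.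
  by rewrite integral_normal_pdf mule1.
rewrite -ge0_integralZl; first last.
- by rewrite lee_fin expR_ge0.
- by move=> x _; rewrite lee_fin normal_pdf_ge0.
- exact: mp.
- exact: measurableT.
apply: eq_integral => x _; rewrite -!EFinM; congr EFin.
rewrite !normal_pdfE// mulrCA [RHS]mulrCA; congr (_ * _)%R.
rewrite /w /normal_fun -!expRD; congr expR.
by field.
Qed.

(** Linear functionals of the noise may vanish almost surely, so the point mass has to belong to the
    family. *)
Definition cgauss (s : R) : probability (measurableTypeR R) R :=
  if s == 0%R then (\d_(0%R : measurableTypeR R) : probability (measurableTypeR R) R)
  else (normal_prob 0 s : probability (measurableTypeR R) R).

Lemma cgauss_dirac (f : R -> \bar R) : measurable_fun setT f ->
  \int[cgauss 0]_x f x = f 0%R.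
Proof. by move=> mf; rewrite /cgauss eqxx integral_dirac// diracT mul1e. Qed.

Lemma cgaussE (s : R) : s != 0%R -> cgauss s = normal_prob 0 s.
Proof. by rewrite /cgauss => /negbTE ->. Qed.

(** The value is never computed. Where finiteness and positivity matter, they follow from a Gaussian
    coordinate with known finite positive second moment. *)
Definition normal_moment2 : \bar R := \int[normal_prob 0 1]_x ((x ^+ 2)%R)%:E.

Lemma normal_peakM (s t : R) : (0 < s)%R ->
  (normal_peak (s * t) = s^-1 * normal_peak t)%R.
Proof.
move=> s0; rewrite /normal_peak.
have -> : ((s * t) ^+ 2 * pi *+ 2 = s ^+ 2 * (t ^+ 2 * pi *+ 2))%R.
  by rewrite exprMn -mulrA mulrnAr.
by rewrite sqrtrM ?sqr_ge0// sqrtr_sqr gtr0_norm// invfM.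
Qed.

Lemma cgauss_moment2 (s : R) : (0 <= s)%R ->
  \int[cgauss s]_x ((x ^+ 2)%R)%:E = (s ^+ 2)%:E * normal_moment2.
Proof.
have m2 : measurable_fun [set: R] (fun x : R => ((x ^+ 2)%R)%:E).
  by apply/measurable_EFinP; exact: measurable_funX.
have p2 (x : R) : 0 <= ((x ^+ 2)%R)%:E by rewrite lee_fin sqr_ge0.
rewrite le_eqVlt => /predU1P[<-|s0].
  by rewrite cgauss_dirac// expr0n mul0e.
rewrite cgaussE ?gt_eqF// /normal_moment2 !ge0_integral_normal_prob//.
under eq_integral do rewrite -EFinM.
have FE : ((fun x : R => s * x)^`())%classic%R = cst s.
  apply/funext => x; rewrite derive1E deriveM// derive_cst derive_id scaler0.
  by rewrite addr0 [_ *: _]mulr1.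
rewrite (@increasing_ge0_integration_by_substitutionT _ (fun x : R => s * x)%R
    (fun x : R => x ^+ 2 * normal_pdf 0 s x)%R).
- rewrite FE -ge0_integralZl//.
  + apply: eq_integral => x _; rewrite -!EFinM; congr EFin.
    transitivity ((s * x) ^+ 2 * normal_pdf 0 s (s * x) * s)%R; first by [].
    rewrite !normal_pdfE ?gt_eqF// -[X in normal_peak X](mulr1 s) normal_peakM//.
    rewrite /normal_fun.
    have -> : (- (s * x - 0) ^+ 2 / (s ^+ 2 *+ 2) = - (x - 0) ^+ 2 / (1 ^+ 2 *+ 2))%R.
      by field; rewrite gt_eqF.
    by field; rewrite gt_eqF.
  + apply: emeasurable_funM => //; apply/measurable_EFinP.
    exact: measurable_normal_pdf.
  + by move=> x _; rewrite mule_ge0// lee_fin normal_pdf_ge0.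
- by move=> x y xy; rewrite ltr_pM2l.
- by rewrite FE => x; exact: cvg_cst.
- by rewrite FE; exact: is_cvg_cst.
- by rewrite FE; exact: is_cvg_cst.
- by move=> x; exact: derivableM.
- exact/gt0_cvgMrNy.
- exact/gt0_cvgMry.
- move=> x; apply: cvgM; first exact: exprn_continuous.
  by apply: continuous_normal_pdf; rewrite gt_eqF.
- by move=> x; rewrite mulr_ge0 ?sqr_ge0// normal_pdf_ge0.
Qed.

Lemma ge0_integral_lebesgueN (f : R -> \bar R) :
  measurable_fun setT f -> (forall x, 0 <= f x) ->
  \int[leb]_x f (- x)%R = \int[leb]_x f x.
Proof.
move=> mf f0; pose op : R -> measurableTypeR R := -%R.
have mop : measurable_fun setT op by exact: oppr_measurable.
transitivity (\int[pushforward leb op]_x f x).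
  by rewrite ge0_integral_pushforward.
by apply: eq_measure_integral => A mA _; exact: lebesgue_measureN.
Qed.

Lemma ge0_integral_cgaussN (s : R) (f : R -> \bar R) :
  measurable_fun setT f -> (forall x, 0 <= f x) ->
  \int[cgauss s]_x f (- x)%R = \int[cgauss s]_x f x.
Proof.
move=> mf f0; have mfN : measurable_fun setT (fun x : R => f (- x)%R).
  by apply: (measurableT_comp mf); exact: oppr_measurable.
have [->|s0] := eqVneq s 0%R; first by rewrite !cgauss_dirac// oppr0.
rewrite cgaussE// !ge0_integral_normal_prob//.
rewrite -[RHS]ge0_integral_lebesgueN.
- apply: eq_integral => x _; rewrite !normal_pdfE// /normal_fun.
  by rewrite !subr0 sqrrN.
- apply: emeasurable_funM => //; apply/measurable_EFinP.
  exact: measurable_normal_pdf.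
- by move=> x; rewrite mule_ge0// lee_fin normal_pdf_ge0.
Qed.

Lemma normal_convolution (s1 s2 : R) (g : R -> \bar R) :
  (0 < s1)%R -> (0 < s2)%R -> measurable_fun setT g -> (forall x, 0 <= g x) ->
  \int[normal_prob 0 s1]_v \int[normal_prob 0 s2]_w g (v + w)%R
  = \int[normal_prob 0 (Num.sqrt (s1 ^+ 2 + s2 ^+ 2))]_u g u.
Proof.
move=> s10 s20 mg g0; set s := Num.sqrt _.
have sg0 : (0 < s1 ^+ 2 + s2 ^+ 2)%R by rewrite addr_gt0// exprn_gt0.
have s0 : (0 < s)%R by rewrite sqrtr_gt0.
have sE : (s ^+ 2 = s1 ^+ 2 + s2 ^+ 2)%R by rewrite sqr_sqrtr// ltW.
have mp (m t : R) : measurable_fun setT (fun x => (normal_pdf m t x)%:E).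
  by apply/measurable_EFinP; exact: measurable_normal_pdf.
have p0 (m t x : R) : 0 <= (normal_pdf m t x)%:E by rewrite lee_fin normal_pdf_ge0.
pose h (z : R * R) := g z.2 * (normal_pdf 0 s2 (z.2 - z.1))%:E * (normal_pdf 0 s1 z.1)%:E.
have h0 z : 0 <= h z by rewrite !mule_ge0.
have mh : measurable_fun setT h.
  apply: emeasurable_funM; last exact: (measurableT_comp (mp _ _)).
  apply: emeasurable_funM; first exact: measurableT_comp.
  by apply: (measurableT_comp (mp _ _)); exact: measurable_funB.
have inner (v : R) : \int[normal_prob 0 s2]_w g (v + w)%R =
    \int[leb]_u (g u * (normal_pdf 0 s2 (u - v))%:E).
  rewrite (@ge0_integral_normal_prob 0 s2 (fun w => g (v + w)%R)); first last.
  - by [].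
  - by apply: measurableT_comp => //; exact: measurable_funD.
  rewrite -[RHS](ge0_integral_lebesgueDr v).
  - by apply: eq_integral => x _; rewrite addrK addrC.
  - apply: emeasurable_funM => //; apply: (measurableT_comp (mp _ _)).
    exact: measurable_funB.
  - by move=> x; rewrite mule_ge0.
rewrite (@ge0_integral_normal_prob 0 s1
  (fun v => \int[normal_prob 0 s2]_w g (v + w)%R)); last 2 first.
- under eq_fun do rewrite inner.
  apply: (@measurable_fun_fubini_tonelli_F _ _ _ _ _ leb
     (fun z : R * R => g z.2 * (normal_pdf 0 s2 (z.2 - z.1))%:E)).
  + apply: emeasurable_funM; first exact: measurableT_comp.
    by apply: (measurableT_comp (mp _ _)); exact: measurable_funB.
  + by move=> x; rewrite mule_ge0.
- by move=> x; exact: integral_ge0.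
transitivity (\int[leb]_v \int[leb]_u h (v, u)).
  apply: eq_integral => v _; rewrite inner -ge0_integralZr//.
  - apply: emeasurable_funM => //; apply: (measurableT_comp (mp _ _)).
    exact: measurable_funB.
  - by move=> u _; rewrite mule_ge0.
transitivity (\int[leb]_u \int[leb]_v h (v, u)).
  exact: (@fubini_tonelli _ _ _ _ _ leb leb h mh h0).
rewrite (@ge0_integral_normal_prob 0 s g mg g0); apply: eq_integral => u _.
(* Completing the square in v: given v + w = u, the variable v is normal with mean [m] and standard
   deviation [t], and its density integrates to 1. *)
pose m := (u * s1 ^+ 2 / s ^+ 2)%R; pose t := (s1 * (s2 / s))%R.
have s1n : s1 != 0%R by rewrite gt_eqF.
have s2n : s2 != 0%R by rewrite gt_eqF.
have sn : s != 0%R by rewrite gt_eqF.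
have ssn : (s1 ^+ 2 + s2 ^+ 2 != 0)%R by rewrite gt_eqF.
have tn : t != 0%R by rewrite /t !mulf_neq0// invr_eq0.
transitivity (\int[leb]_v (g u * (normal_pdf 0 s u)%:E * (normal_pdf m t v)%:E)).
  apply: eq_integral => v _; rewrite /h/= -!muleA -!EFinM; congr (_ * _%:E).
  rewrite !normal_pdfE// /t normal_peakM//.
  have -> : normal_peak s2 = (s^-1 * normal_peak (s2 / s))%R.
    by rewrite -normal_peakM// mulrCA divff// mulr1.
  have -> : normal_peak s1 = (s1^-1 * normal_peak 1)%R.
    by rewrite -normal_peakM// mulr1.
  have -> : normal_peak s = (s^-1 * normal_peak 1)%R.
    by rewrite -normal_peakM// mulr1.
  rewrite /normal_fun.
  rewrite (_ : forall a b c d e f : R, a * b * e * (c * d * f) =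
    a * b * c * d * (e * f))%R; last by move=> *; ring.
  rewrite (_ : forall a b c d e f : R, a * b * e * (c * d * f) =
    a * b * c * d * (e * f))%R; last by move=> *; ring.
  rewrite -!expRD; congr (_ * expR _)%R; first by ring.
  have -> : ((s1 * (s2 / s)) ^+ 2 = s1 ^+ 2 * s2 ^+ 2 / s ^+ 2)%R by field.
  rewrite /m sE.
  by field; rewrite s1n s2n ssn.
rewrite ge0_integralZl; first by rewrite integral_normal_pdf mule1.
- exact: measurableT.
- exact: mp.
- by [].
- by rewrite mule_ge0.
Qed.

Lemma cgauss_convolution (s1 s2 : R) (g : R -> \bar R) :
  (0 <= s1)%R -> (0 <= s2)%R -> measurable_fun setT g -> (forall x, 0 <= g x) ->
  \int[cgauss s1]_v \int[cgauss s2]_w g (v + w)%R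
  = \int[cgauss (Num.sqrt (s1 ^+ 2 + s2 ^+ 2))]_u g u.
Proof.
move=> + + mg g0.
have mgD (v : R) : measurable_fun setT (fun w => g (v + w)%R).
  by apply: measurableT_comp => //; exact: measurable_funD.
rewrite le_eqVlt => /predU1P[<-|s10] s20.
  have -> : Num.sqrt (0 ^+ 2 + s2 ^+ 2) = s2.
    by rewrite expr0n/= add0r sqrtr_sqr ger0_norm.
  rewrite (@cgauss_dirac (fun v => \int[cgauss s2]_w g (v + w)%R)).
    by apply: eq_integral => w _; rewrite add0r.
  apply: (@measurable_fun_fubini_tonelli_F _ _ _ _ _ (cgauss s2)
    (fun z : R * R => g (z.1 + z.2)%R)) => //.
  by apply: measurableT_comp => //; exact: measurable_funD.
move: s20; rewrite le_eqVlt => /predU1P[<-|s20].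
  have -> : Num.sqrt (s1 ^+ 2 + 0 ^+ 2) = s1.
    by rewrite expr0n/= addr0 sqrtr_sqr gtr0_norm.
  apply: eq_integral => v _.
  by rewrite (@cgauss_dirac (fun w => g (v + w)%R))// addr0.
rewrite (@cgaussE s1) ?gt_eqF// (@cgaussE s2) ?gt_eqF//.
have s0 : (0 < Num.sqrt (s1 ^+ 2 + s2 ^+ 2))%R.
  by rewrite sqrtr_gt0 addr_gt0// exprn_gt0.
rewrite (@cgaussE (Num.sqrt (s1 ^+ 2 + s2 ^+ 2))); last by rewrite gt_eqF.
exact: (normal_convolution s10 s20 mg g0).
Qed.

Section law.
Context d (T : measurableType d) (P : probability T R).

Definition gaussian_law (X : T -> R) (s : R) : Prop :=
  [/\ measurable_fun setT X, (0 <= s)%R &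
      forall A : set R, measurable A -> P (X @^-1` A) = cgauss s A].

Lemma centered_gaussianP (X : T -> R) :
  centered_gaussian P X -> exists s : R, gaussian_law X s.
Proof.
case=> mX [s s0 XE]; exists s; split => // A mA.
by rewrite XE// /cgauss; case: ifP.
Qed.

Lemma ge0_integral_gaussian_law (X : T -> R) (s : R) (g : R -> \bar R) :
  gaussian_law X s -> measurable_fun setT g -> (forall x, 0 <= g x) ->
  \int[P]_x g (X x) = \int[cgauss s]_x g x.
Proof.
move=> [mX s0 XE] mg g0.
pose Xr : T -> measurableTypeR R := X.
have mXr : measurable_fun setT Xr by exact: mX.
transitivity (\int[pushforward P Xr]_x g x).
  by rewrite ge0_integral_pushforward.
by apply: eq_measure_integral => A mA _; exact: XE.
Qed.

(** By symmetry the positive and negative parts have the same integral. If it is finite the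
    difference is 0; otherwise the difference is infinite and [fine] sends it to 0. *)
Lemma gaussian_law_mean (X : T -> R) (s : R) :
  gaussian_law X s -> fine (\int[P]_x (X x)%:E) = 0%R.
Proof.
move=> XE; have [mX s0 _] := XE.
pose pos (x : R) : \bar R := (Num.max x 0)%:E.
have mpos : measurable_fun setT pos.
  by apply/measurable_EFinP; exact: measurable_maxr.
have pos0 x : 0 <= pos x by rewrite lee_fin le_max lexx orbT.
rewrite integralE.
have -> : \int[P]_x ((fun x => (X x)%:E)^\+ x) = \int[cgauss s]_x pos x.
  rewrite -(ge0_integral_gaussian_law XE)//; apply: eq_integral => x _.
  by rewrite funeposE /pos EFin_max.
have -> : \int[P]_x ((fun x => (X x)%:E)^\- x) = \int[cgauss s]_x pos x.
  rewrite -[RHS]ge0_integral_cgaussN//.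
  rewrite -(ge0_integral_gaussian_law XE (g := fun x => pos (- x)%R))//.
    by apply: eq_integral => x _; rewrite funenegE /pos EFin_max EFinN.
  by apply: (measurableT_comp mpos); exact: oppr_measurable.
have : 0 <= \int[cgauss s]_x pos x by exact: integral_ge0.
by case: (\int[cgauss s]_x pos x) => //= r _; rewrite subrr.
Qed.

Lemma gaussian_law_moment2 (X : T -> R) (s : R) : gaussian_law X s ->
  \int[P]_x ((X x ^+ 2)%R)%:E = (s ^+ 2)%:E * normal_moment2.
Proof.
move=> XE; have [mX s0 _] := XE; rewrite -cgauss_moment2//.
rewrite -(ge0_integral_gaussian_law XE)// => [|x].
  by apply/measurable_EFinP; exact: measurable_funX.
by rewrite lee_fin sqr_ge0.
Qed.

Lemma gaussian_law_variance (X : T -> R) (s : R) : gaussian_law X s ->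
  covariance P X X = (s ^+ 2)%:E * normal_moment2.
Proof.
move=> XE; rewrite -(gaussian_law_moment2 XE) unlock.
rewrite [in fine _]unlock (gaussian_law_mean XE) unlock.
apply: eq_integral => x _; congr EFin.
transitivity ((X x - 0) * (X x - 0))%R; first by [].
by rewrite subr0.
Qed.

End law.

End normal.

(** * The Cramer-Wold theorem *)

Section step_polynomial.
Context {R : realType}.

Lemma bernoulli_inequality (y : R) (k : nat) :
  -1 <= y -> 1 + k%:R * y <= (1 + y) ^+ k.
Proof.
move=> y1; elim: k => [|k IH]; first by rewrite mul0r addr0.
rewrite exprS; apply: (@le_trans _ _ ((1 + y) * (1 + k%:R * y))).
  have : 0 <= k%:R * (y ^+ 2) by rewrite mulr_ge0// sqr_ge0.
  by rewrite -natr1; lra.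
by rewrite ler_wpM2l//; lra.
Qed.

(* The polynomials of Brosowski and Deutsch's proof of the Stone-Weierstrass
   theorem. *)
Definition step_poly (n : nat) (x : R) : R :=
  1 - (1 - x ^+ (n * n.+1)) ^+ (2 ^ (n * n)).

Lemma step_poly_itv n (x : R) : 0 <= x <= 1 -> 0 <= step_poly n x <= 1.
Proof.
move=> /andP[x0 x1]; rewrite /step_poly subr_ge0 lerBlDr lerDl.
have := exprn_ge0 (n * n.+1) x0; have := exprn_ile1 (n * n.+1) x0 x1.
by move=> h1 h0; rewrite exprn_ge0 ?exprn_ile1//; lra.
Qed.

(** Put y = x^(n (n + 1)) and k = 2^(n n). For x <= 1/2, Bernoulli's inequality bounds the
    polynomial by k y <= 2^-n. For x > 1/2, (1 - y)^k (1 + y)^k <= 1 bounds its distance to 1 by 1 /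
    (1 + k y), and k y = ((2 x)^n x)^n is at least 2^n once (2 x)^n x >= 2. *)
Lemma step_poly_cvg (x : R) : 0 <= x <= 1 ->
  step_poly n x @[n --> \oo] --> ((2^-1 < x)%R%:R : R).
Proof.
move=> /andP[x0 x1].
have half : `|2^-1 : R| < 1 by rewrite gtr0_norm// invf_lt1// ltr1n.
suff [N hN] : exists N, forall n, (N <= n)%N ->
    `|(2^-1 < x)%R%:R - step_poly n x| <= 2^-1 ^+ n.
  apply/cvgrPdist_le => e e0.
  have /cvgrPdist_le/(_ _ e0)[M _ hM] := cvg_expr half.
  exists (maxn N M) => // n /=; rewrite geq_max => /andP[Nn Mn].
  apply: le_trans (hN _ Nn) _; have := hM n Mn.
  by rewrite sub0r normrN ger0_norm// exprn_ge0.
have y0 n := exprn_ge0 (n * n.+1) x0.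
have y1 n := exprn_ile1 (n * n.+1) x0 x1.
have [xh|xh] := ltP 2^-1 x; last first.
  exists 0%N => n _; have /andP[p0 p1] := step_poly_itv n (introT andP (conj x0 x1)).
  rewrite sub0r normrN ger0_norm// /step_poly.
  have := @bernoulli_inequality (- x ^+ (n * n.+1)) (2 ^ (n * n)).
  have yn1 : -1 <= - x ^+ (n * n.+1) by rewrite lerN2.
  move=> /(_ yn1) B; rewrite lerBlDr -lerBlDl; apply: le_trans B.
  rewrite mulrN lerD2l lerN2.
  apply: (@le_trans _ _ ((2 ^ (n * n))%:R * (2^-1) ^+ (n * n.+1))).
    by rewrite ler_wpM2l// lerXn2r// ?nnegrE// invr_ge0.
  by rewrite mulnS exprD natrX mulrCA -exprMn mulfV// expr1n mulr1.
have t0 : 0 < 2 * x - 1 by lra.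
(* From this index on, Bernoulli gives (2 x)^n >= 1 + n (2 x - 1) >= 4, and x > 1/2 then gives (2
   x)^n x >= 2. *)
pose N := (Num.truncn (3 / (2 * x - 1))).+1; exists N => n Nn.
have [p0 p1] := andP (step_poly_itv n (introT andP (conj x0 x1))).
rewrite ger0_norm ?subr_ge0// /step_poly subKr.
have big : 2 <= (2 * x) ^+ n * x.
  have h : 3 <= n%:R * (2 * x - 1).
    rewrite -ler_pdivrMr//; apply: (@le_trans _ _ N%:R); last by rewrite ler_nat.
    by rewrite ltW// truncnS_gt.
  have := @bernoulli_inequality (2 * x - 1) n.
  have -> : 1 + (2 * x - 1) = 2 * x by ring.
  move=> B.
  have : 4 <= (2 * x) ^+ n by apply: le_trans (B _); lra.
  move=> h4; apply: (@le_trans _ _ (4 * x)); first by lra.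
  by rewrite ler_wpM2r.
set y := x ^+ _; have yx0 : 0 <= y by exact: y0.
have yx1 : y <= 1 by exact: y1.
have ky : 2 ^+ n <= (2 ^ (n * n))%:R * y.
  have -> : (2 ^ (n * n))%:R * y = ((2 * x) ^+ n * x) ^+ n.
    by rewrite /y mulnS exprD natrX [RHS]exprMn -exprM exprMn; ring.
  by rewrite lerXn2r ?nnegrE// mulr_ge0 ?exprn_ge0// mulr_ge0.
have z0 : 0 <= (1 - y) ^+ (2 ^ (n * n)) by rewrite exprn_ge0// subr_ge0.
have z1 : (1 - y) ^+ (2 ^ (n * n)) * (1 + (2 ^ (n * n))%:R * y) <= 1.
  apply: (@le_trans _ _ ((1 - y) ^+ (2 ^ (n * n)) * (1 + y) ^+ (2 ^ (n * n)))).
    by rewrite ler_wpM2l// bernoulli_inequality//; lra.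
  rewrite -exprMn; apply: exprn_ile1.
    by rewrite mulr_ge0//; lra.
  have : 0 <= y ^+ 2 by exact: sqr_ge0.
  by lra.
rewrite exprVn -[leRHS]mul1r ler_pdivlMr ?exprn_gt0//.
apply: le_trans z1; apply: ler_wpM2l => //.
by apply: le_trans ky _; lra.
Qed.

End step_polynomial.

Section cramer_wold.
Context d (T : measurableType d) {R : realType}.
Variable G : set (T -> R).
Hypothesis G_measurable : forall f, G f -> measurable_fun setT f.
Hypothesis G0 : G (fun=> 0).
Hypothesis GD : forall f g, G f -> G g -> G (fun x => f x + g x).
Hypothesis GZ : forall k f, G f -> G (fun x => k * f x).

(** A real form of the span of the characters exp (i f): the phase [r] includes the sines, and the
    product-to-sum formula makes the family an algebra. *)
Inductive trig_sum : (T -> R) -> Prop :=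
| trig_cos a f r : G f -> trig_sum (fun x => a * cos (f x + r))
| trig_add f g : trig_sum f -> trig_sum g -> trig_sum (fun x => f x + g x).

Lemma trig_sum_eq f g : trig_sum f -> f =1 g -> trig_sum g.
Proof. by move=> tf /funext <-. Qed.

Lemma trig_sum_cst a : trig_sum (fun=> a).
Proof.
apply: (trig_sum_eq (trig_cos a 0 G0)) => x.
by rewrite addr0 cos0 mulr1.
Qed.

Let GB f g : G f -> G g -> G (fun x => f x - g x).
Proof.
move=> Gf Gg; have -> : (fun x => f x - g x) = (fun x => f x + (-1) * g x).
  by apply/funext => x; rewrite mulN1r.
by apply: GD => //; exact: GZ.
Qed.

Lemma trig_sumM f g : trig_sum f -> trig_sum g -> trig_sum (fun x => f x * g x).
Proof.
move=> tf; elim: tf g => [a f1 r Gf1 g tg|f1 f2 tf1 IH1 tf2 IH2 g tg]; last first.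
  by apply: (trig_sum_eq (trig_add (IH1 _ tg) (IH2 _ tg))) => x; rewrite mulrDl.
elim: tg => [b g1 s Gg1|g1 g2 tg1 IH1 tg2 IH2]; last first.
  by apply: (trig_sum_eq (trig_add IH1 IH2)) => x; rewrite mulrDr.
apply: (trig_sum_eq (trig_add (trig_cos (a * b / 2) (r + s) (GD Gf1 Gg1))
  (trig_cos (a * b / 2) (r - s) (GB Gf1 Gg1)))) => x.
have -> : f1 x + g1 x + (r + s) = (f1 x + r) + (g1 x + s) by ring.
have -> : f1 x - g1 x + (r - s) = (f1 x + r) - (g1 x + s) by ring.
by rewrite cosD cosB; field.
Qed.

Lemma trig_sumX f n : trig_sum f -> trig_sum (fun x => f x ^+ n).
Proof.
move=> tf; elim: n => [|n IH]; first exact: trig_sum_cst.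
by apply: (trig_sum_eq (trig_sumM tf IH)) => x; rewrite exprS.
Qed.

Lemma trig_sumB1 f : trig_sum f -> trig_sum (fun x => 1 - f x).
Proof.
move=> tf; apply: (trig_sum_eq (trig_add (trig_sum_cst 1)
  (trig_sumM (trig_sum_cst (-1)) tf))) => x.
by rewrite mulN1r.
Qed.

Lemma trig_sum_measurable f : trig_sum f -> measurable_fun setT f.
Proof.
elim=> [a g r Gg|g h _ mg _ mh]; last exact: measurable_funD.
apply: measurable_funM => //; apply: measurableT_comp.
  by apply: continuous_measurable_fun; exact: continuous_cos.
by apply: measurable_funD => //; exact: G_measurable.
Qed.

Lemma trig_sum_bounded f : trig_sum f -> exists M, forall x, `|f x| <= M.
Proof.
elim=> [a g r _|g h _ [M hM] _ [M' hM']].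
  exists `|a| => x; rewrite normrM ler_piMr//.
  by rewrite ler_norml cos_geN1 cos_le1.
by exists (M + M') => x; rewrite (le_trans (ler_normD _ _))// lerD.
Qed.

Variables P Q : probability T R.
Hypothesis same_law : forall f, G f -> forall g : R -> \bar R,
  measurable_fun setT g -> (forall x, (0 <= g x)%E) ->
  (\int[P]_x g (f x) = \int[Q]_x g (f x))%E.

Let trig_integrable (mu : probability T R) f :
  trig_sum f -> mu.-integrable setT (EFin \o f).
Proof.
move=> tf; apply: measurable_bounded_integrable => //.
- by rewrite (le_lt_trans (probability_le1 _ _))// ltry.
- exact: trig_sum_measurable.
- have [M hM] := trig_sum_bounded tf.
  exists M; split; first exact: num_real.
  by move=> y My x _ /=; rewrite (le_trans (hM x))// ltW.
Qed.

(** As [same_law] compares integrals of nonnegative functions, it is applied to 1 + cos, and the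
    finite contribution of 1 is cancelled. *)
Lemma trig_sum_integral f : trig_sum f ->
  (\int[P]_x (f x)%:E = \int[Q]_x (f x)%:E)%E.
Proof.
elim=> [a g r Gg|g h tg IHg th IHh]; last first.
  by rewrite !(@integralD_EFin _ _ _ _ setT measurableT g h)// ?IHg ?IHh//;
    exact: trig_integrable.
have tc : trig_sum (fun x => 1 * cos (g x + r)) by exact: trig_cos.
have mc : measurable_fun [set: R] (fun y : R => (1 + cos (y + r))%:E).
  apply/measurable_EFinP; apply: measurable_funD => //.
  apply: measurableT_comp; last exact: measurable_funD.
  by apply: continuous_measurable_fun; exact: continuous_cos.
have c0 (y : R) : (0 <= (1 + cos (y + r))%:E)%E.
  by rewrite lee_fin; have := cos_geN1 (y + r); lra.
have key (mu : probability T R) :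
    (\int[mu]_x (1 + cos (g x + r))%:E = 1 + \int[mu]_x (cos (g x + r))%:E)%E.
  rewrite (@integralD_EFin _ _ _ _ setT measurableT (fun=> 1)
    (fun x => cos (g x + r))).
  - have -> // : (\int[mu]_x (1%R)%:E = 1)%E.
    by rewrite integral_cst// mul1e; exact: probability_setT.
  - exact: (trig_integrable mu (trig_sum_cst 1)).
  - apply: (trig_integrable mu); apply: (trig_sum_eq tc) => x.
    by rewrite mul1r.
have ic (mu : probability T R) : mu.-integrable setT (fun x => (cos (g x + r))%:E).
  by apply: (trig_integrable mu); apply: (trig_sum_eq tc) => x; rewrite mul1r.
have add1I (u v : \bar R) : (1 + u = 1 + v)%E -> u = v.
  by case: u v => [u||] [v||] //= [] /addrI ->.
have := same_law Gg mc c0; rewrite !key => /add1I E.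
have Z (mu : probability T R) : (\int[mu]_x (a * cos (g x + r))%:E =
    a%:E * \int[mu]_x (cos (g x + r))%:E)%E.
  rewrite -(integralZl measurableT (ic mu)).
  by apply: eq_integral => x _; rewrite EFinM.
by rewrite !Z E.
Qed.

(* The indicator of [sin (f + r) > 0] is a limit of step polynomials in
   [(1 + sin (f + r)) / 2], and [f > c] is the inferior limit of the sets
   [sin ((f - c) / n) > 0]; no characteristic function is inverted. *)
Let step_sets : set (set T) := [set A | measurable A /\
  exists h : nat -> T -> R, [/\ forall n, trig_sum (h n),
    forall n x, 0 <= h n x <= 1 &
    forall x, h n x @[n --> \oo] --> (\1_A x : R)]].

Let step_setsI : setI_closed step_sets.
Proof.
move=> A B [mA [h [th h01 hA]]] [mB [k [tk k01 kB]]].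
split; first exact: measurableI.
exists (fun n x => h n x * k n x); split => [n|n x|x].
- exact: trig_sumM.
- have /andP[h0 h1] := h01 n x; have /andP[k0 k1] := k01 n x.
  by rewrite mulr_ge0//= mulr_ile1.
- by rewrite indicI; apply: cvgM; [exact: hA|exact: kB].
Qed.

Let step_sets_setT : step_sets setT.
Proof.
split=> //; exists (fun _ _ => 1); split => [n|n x|x].
- exact: trig_sum_cst.
- by rewrite ler01 lexx.
- by rewrite indicT; exact: cvg_cst.
Qed.

Let step_sets_measure A : step_sets A -> P A = Q A.
Proof.
move=> [mA [h [th h01 hA]]].
have lim (mu : probability T R) :
    (\int[mu]_x (h n x)%:E)%E @[n --> \oo] --> mu A.
  have [] := @dominated_convergence _ _ _ mu setT measurableT
    (fun n x => (h n x)%:E) (fun x => (\1_A x)%:E) (cst 1%E).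
  - by move=> n; apply/measurable_EFinP; exact: trig_sum_measurable.
  - by apply/measurable_EFinP; exact: measurable_indic.
  - by apply: aeW => x _; apply: cvg_EFin; [exact: nearW|exact: hA].
  - exact: (trig_integrable mu (trig_sum_cst 1)).
  - apply: aeW => x n _; have /andP[h0 h1] := h01 n x.
    by rewrite gee0_abs lee_fin.
  - by move=> _ _; rewrite integral_indic// setIT.
have E : (fun n => \int[P]_x (h n x)%:E)%E = (fun n => \int[Q]_x (h n x)%:E)%E.
  by apply/funext => n; exact: trig_sum_integral.
have := lim P; rewrite E => lP; have lQ := lim Q.
exact: (cvg_unique _ lP lQ).
Qed.

Let sin_step f r : G f -> step_sets [set x | 0 < sin (f x + r)].
Proof.
move=> Gf; pose g x := (1 + sin (f x + r)) / 2.
have tg : trig_sum g.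
  apply: (trig_sum_eq (trig_add (trig_sum_cst 2^-1)
    (trig_cos 2^-1 (r - pi / 2) Gf))) => x.
  by rewrite addrA cosBpihalf /g; field.
have g01 x : 0 <= g x <= 1.
  have := sin_geN1 (f x + r); have := sin_le1 (f x + r) => h1 h2.
  by rewrite /g; apply/andP; split; lra.
split.
  have -> : [set x | 0 < sin (f x + r)] = g @^-1` `]2^-1, +oo[%classic.
    by apply/seteqP; split => x /=; rewrite in_itv/= andbT /g; lra.
  by rewrite -[X in measurable X]setTI; exact: (trig_sum_measurable tg).
exists (fun n x => step_poly n (g x)); split => [n|n x|x].
- exact/trig_sumB1/trig_sumX/trig_sumB1/trig_sumX.
- exact: step_poly_itv.
- have -> : \1_[set x | 0 < sin (f x + r)] x = (2^-1 < g x)%R%:R :> R.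
    rewrite indicE; congr ((nat_of_bool _)%:R); apply/idP/idP.
      by rewrite inE /= /g => ?; lra.
    by rewrite inE /= /g => ?; lra.
  exact: step_poly_cvg.
Qed.

Let G_step_measurable f : G f ->
  measurable_fun (setT : set (g_sigma_algebraType step_sets)) f.
Proof.
move=> Gf; apply: (measurability _ (RGenOInfty.measurableE R)) => //.
move=> _ [_ [c ->] <-]; rewrite setTI.
pose S n := [set x | 0 < sin (n.+1%:R^-1 * f x - n.+1%:R^-1 * c)].
have -> : f @^-1` `]c, +oo[%classic = \bigcup_N \bigcap_(n in [set n | (N <= n)%N]) S n.
  (* Below 1 < pi in absolute value, the argument of the sine has the sign of the sine, so
     eventually x lies in [S n] exactly when f x > c. *)
  have near x : exists N, forall n, (N <= n)%N -> `|n.+1%:R^-1 * f x - n.+1%:R^-1 * c| < 1.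
    exists (Num.truncn `|f x - c|) => n Nn.
    rewrite -mulrBr normrM gtr0_norm ?invr_gt0// mulrC ltr_pdivrMr// mul1r.
    by rewrite (lt_le_trans (truncnS_gt _))// ler_nat ltnS.
  apply/seteqP; split => x /=.
    rewrite in_itv/= andbT => cx; have [N hN] := near x; exists N => // n /= Nn.
    have := hN n Nn; rewrite /S /= -mulrBr => h; apply: sin_gt0_pi.
    rewrite mulr_gt0 ?invr_gt0 ?subr_gt0//=.
    have := pi_ge2 R; move: h; rewrite ltr_norml => /andP[_ h] p2.
    by apply: lt_le_trans h _; lra.
  move=> [N _ hN]; have [M hM] := near x; rewrite in_itv/= andbT ltNge.
  apply/negP => xc; have := hN (maxn N M) (leq_maxl _ _); rewrite /S /= ltNge => /negP; apply.
  have := hM (maxn N M) (leq_maxr _ _); rewrite -mulrBr.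
  set z := _ * (f x - c) => z1.
  have z0 : z <= 0 by rewrite /z mulr_ge0_le0 ?invr_ge0// subr_le0.
  rewrite -[z]opprK sinN oppr_le0 sin_ge0_pi// oppr_ge0 z0/=.
  have := pi_ge2 R; move: z1; rewrite ltr_norml => /andP[h _] p2.
  by lra.
apply: bigcup_measurable => N _; apply: bigcap_measurable; first by exists N => /=.
move=> n _; apply: sub_sigma_algebra; apply: sin_step; exact: GZ.
Qed.

(** The two laws agree on the pi-system [step_sets], and every functional in [G] is measurable for
    the sigma-algebra it generates. *)
Lemma cramer_wold : @measurable _ T `<=`
    <<s [set A | exists f, G f /\ exists2 B : set R, measurable B & A = f @^-1` B] >> ->
  forall A : set T, measurable A -> P A = Q A.
Proof.
move=> genT A mA; apply: (measure_unique step_sets (fun=> setT)); last exact: mA.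
- apply/seteqP; split; last first.
    apply: smallest_sub; first exact: sigma_algebra_measurable.
    by move=> B [].
  apply: subset_trans genT _; apply: smallest_sub.
    exact: smallest_sigma_algebra.
  move=> _ [f [Gf [B mB ->]]]; rewrite -[X in _ X]setTI.
  exact: (G_step_measurable Gf).
- exact: step_setsI.
- by move=> _; exact: step_sets_setT.
- by rewrite bigcup_const.
- exact: step_sets_measure.
- by move=> _; rewrite (le_lt_trans (probability_le1 _ _))// ltry.
Qed.

End cramer_wold.

(** * Shifts of Gaussian noise *)

Section generated.
Context d (T : measurableType d) {R : realType} (G : set (T -> R)).

Definition functional_sets : set (set T) :=
  [set A | exists f, G f /\ exists2 B : set R, measurable B & A = f @^-1` B].

Hypothesis G_measurable : forall f, G f -> measurable_fun setT f.
Hypothesis genT : @measurable _ T `<=` <<s functional_sets >>.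

Lemma measurable_functionals d' (S : measurableType d') (phi : S -> T) :
  (forall f, G f -> measurable_fun setT (f \o phi)) -> measurable_fun setT phi.
Proof.
move=> mf; apply: (measurability functional_sets).
  apply/seteqP; split => //; apply: smallest_sub.
    exact: sigma_algebra_measurable.
  move=> _ [f [Gf [B mB ->]]]; rewrite -[X in measurable X]setTI.
  exact: (G_measurable Gf).
move=> _ [_ [f [Gf [B mB ->]]] <-]; exact: (mf f Gf).
Qed.

End generated.

Section shift_property.
Context d (T : measurableType d) {R : realType} (gamma : probability T R).

(* [O s] is the observation of the signal [s]: the second moments of the
   likelihood ratio between two signals are at most [expR (k * (s - s') ^+ 2)]. *)
Definition shift_property (O : R -> T -> T) (k : R) : Prop :=
  measurable_fun setT (fun z : R * T => O z.1 z.2) /\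
  forall s s' (f : T -> \bar R), measurable_fun setT f ->
    (forall x, (0 <= f x)%E) ->
    ((\int[gamma]_e f (O s e)) * (\int[gamma]_e f (O s e)) <=
     (expR (k * (s - s') ^+ 2))%:E * \int[gamma]_e (f (O s' e) * f (O s' e)))%E.

Lemma shift_property_measurable (O : R -> T -> T) (k : R) s :
  shift_property O k -> measurable_fun setT (O s).
Proof. by move=> [mO _]; exact: (measurableT_comp mO (pair1_measurable s)). Qed.

Lemma shift_property_le (O : R -> T -> T) (k k' : R) :
  k <= k' -> shift_property O k -> shift_property O k'.
Proof.
move=> kk' [mO HO]; split => // s s' f mf f0; apply: (le_trans (HO s s' f mf f0)).
apply: lee_wpmul2r; first by apply: integral_ge0 => x _; rewrite mule_ge0.
by rewrite lee_fin ler_expR ler_wpM2r// sqr_ge0.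
Qed.

End shift_property.

Section gaussian_shift.
Context d (T : measurableType d) {R : realType} (gamma : probability T R).
Variable G : set (T -> R).
Hypothesis G_gaussian : forall f, G f -> centered_gaussian gamma f.
Hypothesis G0 : G (fun=> 0).
Hypothesis GD : forall f g, G f -> G g -> G (fun x => f x + g x).
Hypothesis GZ : forall k f, G f -> G (fun x => k * f x).
Hypothesis genT : @measurable _ T `<=` <<s functional_sets G >>.
Variables (V : T -> R) (Phi : T -> R -> T) (qV : R).
Hypothesis GV : G V.
Hypothesis qV0 : 0 < qV.
Hypothesis VE : (\int[gamma]_x ((V x ^+ 2)%R)%:E = qV%:E)%E.
Hypothesis PhiD : forall e a b, Phi (Phi e a) b = Phi e (a + b).
Hypothesis G_split : forall f, G f -> exists c q q1, [/\
  forall e v, f (Phi e v) = f e + c * v,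
  (\int[gamma]_x ((f x ^+ 2)%R)%:E = q%:E)%E,
  (\int[gamma]_x (((f x - c * V x) ^+ 2)%R)%:E = q1%:E)%E &
  q = q1 + c ^+ 2 * qV].

Let G_measurable f : G f -> measurable_fun setT f.
Proof. by move=> /G_gaussian[]. Qed.

(** The additivity q = q1 + c^2 qV in [G_split] expresses that f - c V and V are uncorrelated. Each
    second moment is the squared scale of the law times [normal_moment2]; cancelling this factor
    turns additivity of moments into additivity of squared scales, as the convolution formula
    requires. *)
Let split f : G f -> exists c s s1 s2, [/\
  forall e v, f (Phi e v) = f e + c * v,
  gaussian_law gamma f s,
  gaussian_law gamma (fun x => f x - c * V x) s1,
  gaussian_law gamma (fun x => c * V x) s2 &
  s = Num.sqrt (s1 ^+ 2 + s2 ^+ 2)].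
Proof.
move=> Gf; have [c [q [q1 [fPhi fq fq1 qE]]]] := G_split Gf.
have GcV : G (fun x => c * V x) by exact: GZ.
have Gf1 : G (fun x => f x - c * V x).
  have -> : (fun x => f x - c * V x) = (fun x => f x + (- c) * V x).
    by apply/funext => x; rewrite mulNr.
  by apply: GD => //; exact: GZ.
have [s fs] := centered_gaussianP (G_gaussian Gf).
have [s1 fs1] := centered_gaussianP (G_gaussian Gf1).
have [s2 fs2] := centered_gaussianP (G_gaussian GcV).
have [sV VsV] := centered_gaussianP (G_gaussian GV).
exists c, s, s1, s2; split => //.
have cVq : (\int[gamma]_x (((c * V x) ^+ 2)%R)%:E = (c ^+ 2 * qV)%:E)%E.
  under eq_integral do rewrite exprMn EFinM.
  rewrite ge0_integralZl//; first by rewrite VE.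
  - by apply/measurable_EFinP; apply: measurable_funX; exact: G_measurable.
  - by move=> x _; rewrite lee_fin sqr_ge0.
  - by rewrite lee_fin sqr_ge0.
have := gaussian_law_moment2 fs; rewrite fq => sE.
have := gaussian_law_moment2 fs1; rewrite fq1 => s1E.
have := gaussian_law_moment2 fs2; rewrite cVq => s2E.
have := gaussian_law_moment2 VsV; rewrite VE => sVE.
have [_ s0 _] := fs.
suff E : s ^+ 2 = s1 ^+ 2 + s2 ^+ 2 by rewrite -E sqrtr_sqr ger0_norm.
have M0 : (0 <= @normal_moment2 R)%E.
  by apply: integral_ge0 => x _; rewrite lee_fin sqr_ge0.
move: M0 sE s1E s2E sVE; case: (@normal_moment2 R) => // [M|]; last first.
  (* An infinite [normal_moment2] is excluded by the coordinate V: its second moment would be 0 or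
     +oo, whereas qV is finite and positive. *)
  move=> _ _ _ _; have [->|sV0] := eqVneq sV 0.
    by rewrite expr0n/= mul0e => -[] E; move: qV0; rewrite E ltxx.
  by rewrite gt0_muley// lte_fin exprn_even_gt0.
rewrite lee_fin -!EFinM => M0 [sE] [s1E] [s2E] [sVE].
have Mn : M != 0.
  by apply/eqP => M00; move: qV0; rewrite sVE M00 mulr0 ltxx.
apply: (mulIf Mn).
by rewrite mulrDl -sE -s1E -s2E.
Qed.

Lemma measurable_shift d' (S : measurableType d') (e : S -> T) (v : S -> R) :
  measurable_fun setT e -> measurable_fun setT v ->
  measurable_fun setT (fun x => Phi (e x) (v x)).
Proof.
move=> me mv; apply: (measurable_functionals G_measurable genT) => f Gf.
have [c [s [s1 [s2 [fPhi _ _ _ _]]]]] := split Gf.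
have -> : f \o (fun x => Phi (e x) (v x)) = (fun x => f (e x) + c * v x).
  by apply/funext => x /=; rewrite fPhi.
apply: measurable_funD; last exact: measurable_funM.
exact: (measurableT_comp (G_measurable Gf)).
Qed.

Variable sV : R.
Hypothesis VsV : gaussian_law gamma V sV.

Let resample (z : T * measurableTypeR R) : T := Phi z.1 (z.2 - V z.1).

Let measurable_resample : measurable_fun setT resample.
Proof.
apply: measurable_shift => //; apply: measurable_funB => //.
by apply: (measurableT_comp (G_measurable GV)).
Qed.

HB.instance Definition _ := isMeasurableFun.Build _ _ _ _ resample
  measurable_resample.

(* [Phi e a] is [e + a u], so [Phi e (v - V e)] is [e] with its coordinate [V]
   replaced by [v]. *)
Lemma gaussian_resample (g : T -> \bar R) :
  measurable_fun setT g -> (forall x, (0 <= g x)%E) ->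
  (\int[gamma]_x g x =
   \int[gamma]_e \int[cgauss sV]_v g (Phi e (v - V e)))%E.
Proof.
have int_resample (h : T -> \bar R) :
    measurable_fun setT h -> (forall x, (0 <= h x)%E) ->
    (\int[distribution (gamma \x cgauss sV)%E resample]_x h x =
     \int[gamma]_e \int[cgauss sV]_v h (Phi e (v - V e)))%E.
  move=> mh h0; rewrite ge0_integral_distribution//.
  rewrite (@fubini_tonelli1 _ _ _ _ _ gamma (cgauss sV) (h \o resample))//.
    exact: measurableT_comp.
  by move=> x; exact: h0.
move=> mg g0; rewrite -int_resample//; apply: eq_measure_integral => A mA _.
(* One functional at a time: resampling turns f into (f - c V)(e) + c v with v independent of e, a
   convolution of two centered normal laws whose variances add up to that of f. *)
apply: (cramer_wold G_measurable G0 GD GZ _ genT mA) => f Gf h mh h0.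
have mhf : measurable_fun setT (h \o f).
  by apply: measurableT_comp => //; exact: G_measurable.
rewrite (int_resample (h \o f))//.
have [c [s [s1 [s2 [fPhi fs fs1 fs2 sE]]]]] := split Gf.
have [_ s10 _] := fs1; have [_ s20 _] := fs2.
have mhD (a : R) : measurable_fun setT (fun w => h (a + w)).
  by apply: measurableT_comp => //; exact: measurable_funD.
rewrite (ge0_integral_gaussian_law fs)// sE -(cgauss_convolution s10 s20)//.
rewrite -(ge0_integral_gaussian_law fs1); last 2 first.
- apply: (@measurable_fun_fubini_tonelli_F _ _ _ _ _ (cgauss s2)
    (fun z : R * R => h (z.1 + z.2))) => //.
  by apply: measurableT_comp => //; exact: measurable_funD.
- by move=> x; exact: integral_ge0.
apply: eq_integral => e _.
rewrite -(ge0_integral_gaussian_law fs2)//.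
rewrite -(ge0_integral_gaussian_law VsV (g := fun v => h (f (Phi e (v - V e)))))//.
- by apply: eq_integral => x _; rewrite fPhi mulrBr addrA addrAC.
- have -> : (fun v => h (f (Phi e (v - V e)))) = (fun v => h (f e + c * (v - V e))).
    by apply/funext => v; rewrite fPhi.
  apply: measurableT_comp => //; apply: measurable_funD => //.
  by apply: measurable_funM => //; exact: measurable_funB.
- by move=> v; exact: h0.
Qed.

(** After resampling, the shift moves only the real variable v. For fixed e the one-dimensional
    bound applies, with a constant that does not depend on e, and the square of the integral over e
    is at most the integral of the square. *)
Lemma gaussian_shift_sqr_le (g : T -> \bar R) (a : R) :
  measurable_fun setT g -> (forall x, (0 <= g x)%E) ->
  ((\int[gamma]_x g (Phi x a)) * (\int[gamma]_x g (Phi x a)) <=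
   (expR (a ^+ 2 / sV ^+ 2))%:E * \int[gamma]_x (g x * g x))%E.
Proof.
move=> mg g0; have sV0 : sV != 0.
  apply/eqP => E; have := gaussian_law_moment2 VsV.
  rewrite VE E expr0n/= mul0e => -[] qE.
  by move: qV0; rewrite qE ltxx.
have mga : measurable_fun setT (fun x => g (Phi x a)).
  by apply: (measurableT_comp mg); exact: measurable_shift.
have mgg : measurable_fun setT (fun x => g x * g x)%E.
  exact: emeasurable_funM.
rewrite (@gaussian_resample (fun x => g x * g x)%E)//; last first.
  by move=> x; rewrite mule_ge0.
pose h e v := g (Phi e (v - V e)).
have mPhi : measurable_fun setT (fun z : T * R => Phi z.1 (z.2 - V z.1)).
  exact: measurable_resample.
have mh e : measurable_fun setT (h e).
  apply: (measurableT_comp mg); apply: measurable_shift => //.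
  exact: measurable_funB.
have mha (b : R) : measurable_fun setT (fun e => \int[cgauss sV]_v h e (v + b)%R)%E.
  apply: (@measurable_fun_fubini_tonelli_F _ _ _ _ _ (cgauss sV)
    (fun z : T * R => h z.1 (z.2 + b))); last by move=> z; exact: g0.
  apply: (measurableT_comp mg); apply: measurable_shift => //.
  apply: measurable_funB; last exact: (measurableT_comp (G_measurable GV)).
  exact: measurable_funD.
have mhh : measurable_fun setT (fun e => \int[cgauss sV]_v (h e v * h e v))%E.
  apply: (@measurable_fun_fubini_tonelli_F _ _ _ _ _ (cgauss sV)
    (fun z : T * R => h z.1 z.2 * h z.1 z.2)%E) => //.
    by apply: emeasurable_funM; exact: (measurableT_comp mg mPhi).
  by move=> x; rewrite mule_ge0// g0.
have -> : (\int[gamma]_x g (Phi x a) =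
    \int[gamma]_e \int[cgauss sV]_v h e (v + a)%R)%E.
  rewrite (gaussian_resample mga)//; apply: eq_integral => e _; apply: eq_integral => v _.
  by rewrite PhiD /h addrAC.
have hi0 e : (0 <= \int[cgauss sV]_v h e (v + a)%R)%E.
  by apply: integral_ge0 => v _; exact: g0.
apply: (le_trans (integral_sqr_le (probability_setT gamma) (mha a) hi0)).
rewrite -ge0_integralZl//; last first.
  by move=> e _; apply: integral_ge0 => v _; rewrite mule_ge0// g0.
apply: ge0_le_integral => //.
- by move=> e _; rewrite mule_ge0.
- exact: emeasurable_funM.
- exact: measurable_funeM.
- move=> e _; rewrite (cgaussE sV0); apply: normal_shift_sqr_le => //.
  by move=> v; exact: g0.
Qed.

(** The observation is a fixed measurable map [Theta] of the shifted noise, so replacing s' by s is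
    a shift by k (s - s') before a function that can be absorbed into the test function. *)
Lemma gaussian_shift_property (Theta : T -> T) (O : R -> T -> T) (k : R) :
  measurable_fun setT Theta -> (forall s e, O s e = Theta (Phi e (k * s))) ->
  shift_property gamma O (k ^+ 2 / sV ^+ 2).
Proof.
move=> mTheta OE.
have mO : measurable_fun setT (fun z : R * T => O z.1 z.2).
  have -> : (fun z : R * T => O z.1 z.2) =
      Theta \o (fun z : R * T => Phi z.2 (k * z.1)).
    by apply/funext => z; exact: OE.
  by apply: (measurableT_comp mTheta); apply: measurable_shift => //;
    exact: measurable_funM.
split => // s s' f mf f0.
have OE' e : O s e = O s' (Phi e (k * (s - s'))).
  by rewrite !OE PhiD; congr (Theta (Phi _ _)); ring.
under eq_integral do rewrite OE'.
have -> : k ^+ 2 / sV ^+ 2 * (s - s') ^+ 2 = (k * (s - s')) ^+ 2 / sV ^+ 2.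
  by rewrite exprMn mulrAC.
apply: (gaussian_shift_sqr_le (g := fun e => f (O s' e))) => //.
apply: (measurableT_comp mf).
exact: (measurableT_comp mO (pair1_measurable s')).
Qed.

End gaussian_shift.

(** * Several independent observations *)

Section tensorization.
Context d (T : measurableType d) {R : realType} (gamma : probability T R).

Definition observe_tuple (O : R -> T -> T) m (s : 'I_m -> R) (e : m.-tuple T) :
    m.-tuple T :=
  [tuple O (s i) (tnth e i) | i < m].

Lemma measurable_observe_tuple (O : R -> T -> T) m (s : 'I_m -> R) :
  (forall s, measurable_fun setT (O s)) ->
  measurable_fun setT (observe_tuple O s).
Proof.
move=> mO; apply/measurable_fun_tnthP => i.
have -> : (@tnth m T)^~ i \o observe_tuple O s = (fun e => O (s i) (tnth e i)).
  by apply/funext => e /=; rewrite tnth_mktuple.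
by apply: (measurableT_comp (mO _)); exact: measurable_tnth.
Qed.

Lemma ge0_integral_iid_lawS m (f : m.+1.-tuple T -> \bar R) :
  measurable_fun setT f -> (forall x, (0 <= f x)%E) ->
  (\int[iid_law gamma m.+1]_e f e =
   \int[gamma]_x \int[iid_law gamma m]_e f (tuple_cons (x, e)))%E.
Proof.
move=> mf f0; rewrite /= ge0_integral_distribution//.
rewrite (@fubini_tonelli1 _ _ _ _ _ gamma (iid_law gamma m)
  (f \o @tuple_cons _ T m))//.
  exact: measurableT_comp.
by move=> x; exact: f0.
Qed.

Lemma observe_tuple_cons (O : R -> T -> T) m (s : 'I_m.+1 -> R) x e :
  observe_tuple O s (tuple_cons (x, e)) =
  tuple_cons (O (s ord0) x, observe_tuple O (s \o lift ord0) e).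
Proof.
apply: eq_from_tnth => i; rewrite tnth_mktuple.
case: (unliftP ord0 i) => [j|] ->.
  by rewrite !tnthS tnth_mktuple.
by rewrite !tnth0.
Qed.

(** By induction: the one-observation bound is applied to the integral [F] over the remaining
    observations, then the induction hypothesis to F x * F x for each x. The exponents add up. *)
Lemma shift_property_tensor (O : R -> T -> T) (k : R) m (s s' : 'I_m -> R)
    (f : m.-tuple T -> \bar R) :
  shift_property gamma O k -> measurable_fun setT f -> (forall x, (0 <= f x)%E) ->
  ((\int[iid_law gamma m]_e f (observe_tuple O s e)) *
   (\int[iid_law gamma m]_e f (observe_tuple O s e)) <=
   (expR (k * \sum_i (s i - s' i) ^+ 2))%:E *
     \int[iid_law gamma m]_e
       (f (observe_tuple O s' e) * f (observe_tuple O s' e)))%E.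
Proof.
move=> OP; have [_ HO] := OP.
have mO t := shift_property_measurable t OP.
elim: m => [|m IH] in s s' f *; move=> mf f0.
  rewrite big_ord0 mulr0 expR0 mul1e /=.
  have ft (t : 0.-tuple T) : f t = f [tuple] by rewrite (tuple0 t).
  under eq_integral do rewrite ft.
  under [in leRHS]eq_integral do rewrite ft.
  by rewrite !integral_dirac// diracT !mul1e.
have mobs (t : 'I_m.+1 -> R) : measurable_fun setT (fun e => f (observe_tuple O t e)).
  by apply: (measurableT_comp mf); exact: measurable_observe_tuple.
rewrite !ge0_integral_iid_lawS//; last 2 first.
- exact: emeasurable_funM.
- by move=> x; rewrite mule_ge0.
pose s0 := s \o lift ord0; pose s0' := s' \o lift ord0.
pose F x := (\int[iid_law gamma m]_e f (tuple_cons (x, observe_tuple O s0 e)))%E.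
pose H x := (\int[iid_law gamma m]_e (f (tuple_cons (x, observe_tuple O s0' e)) *
   f (tuple_cons (x, observe_tuple O s0' e))))%E.
have mcons (t : 'I_m -> R) : measurable_fun setT
    (fun z : T * m.-tuple T => f (tuple_cons (z.1, observe_tuple O t z.2))).
  apply: (measurableT_comp mf); apply: (measurableT_comp (@measurable_tuple_cons _ T m)).
  apply: measurable_fun_pair => //.
  by apply: (measurableT_comp (measurable_observe_tuple t mO)).
have mF : measurable_fun setT F.
  by apply: (@measurable_fun_fubini_tonelli_F _ _ _ _ _ (iid_law gamma m) _ (mcons s0)).
have mH : measurable_fun setT H.
  apply: (@measurable_fun_fubini_tonelli_F _ _ _ _ _ (iid_law gamma m)
    (fun z => f (tuple_cons (z.1, observe_tuple O s0' z.2)) *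
              f (tuple_cons (z.1, observe_tuple O s0' z.2)))%E).
    exact: emeasurable_funM.
  by move=> z; rewrite mule_ge0.
have F0 x : (0 <= F x)%E by exact: integral_ge0.
have H0 x : (0 <= H x)%E by apply: integral_ge0 => e _; rewrite mule_ge0.
have FH x : (F x * F x <= (expR (k * \sum_i (s0 i - s0' i) ^+ 2))%:E * H x)%E.
  apply: (IH s0 s0' (fun t => f (tuple_cons (x, t)))) => //.
  apply: (measurableT_comp mf); apply: (measurableT_comp (@measurable_tuple_cons _ T m)).
  exact: measurable_fun_pair.
under eq_integral do under eq_integral do rewrite observe_tuple_cons.
under [in leRHS]eq_integral do under eq_integral do rewrite observe_tuple_cons.
have mHO : measurable_fun setT (fun x => H (O (s' ord0) x)).
  exact: (measurableT_comp mH (mO _)).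
apply: (le_trans (HO (s ord0) (s' ord0) F mF F0)).
rewrite big_ord_recl mulrDr expRD EFinM -muleA.
rewrite lee_wpmul2l// ?lee_fin ?expR_ge0//.
rewrite -ge0_integralZl//; last by move=> x _; exact: (H0 (O (s' ord0) x)).
apply: ge0_le_integral => //.
- by move=> x _; rewrite mule_ge0.
- by apply: emeasurable_funM; exact: (measurableT_comp mF (mO _)).
- exact: measurable_funeM.
Qed.

End tensorization.

(** * Borel sets of a separable Hilbert space *)

Section inner_product.
Context {R : realType} {H : hilbertType R}.
Implicit Types x y z : H.

Lemma innerDr x y z : inner x (y + z) = inner x y + inner x z.
Proof. by rewrite innerC innerDl ![inner _ x]innerC. Qed.

Lemma innerZr k x y : inner x (k *: y) = k * inner x y.
Proof. by rewrite innerC innerZl innerC. Qed.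

Lemma inner0l x : inner 0 x = 0.
Proof. by rewrite -(scale0r x) innerZl mul0r. Qed.

Lemma inner0r x : inner x 0 = 0.
Proof. by rewrite innerC inner0l. Qed.

Lemma innerBl x y z : inner (x - y) z = inner x z - inner y z.
Proof. by rewrite -scaleN1r innerDl innerZl mulN1r. Qed.

Lemma innerBr x y z : inner x (y - z) = inner x y - inner x z.
Proof. by rewrite -scaleN1r innerDr innerZr mulN1r. Qed.

Lemma inner_cauchy_schwarz x y : `|inner x y| <= `|x| * `|y|.
Proof.
have [->|y0] := eqVneq y 0; first by rewrite inner0r !normr0 mulr0.
have ny : 0 < `|y| ^+ 2 by rewrite exprn_gt0// normr_gt0.
have : 0 <= `|x - (inner x y / `|y| ^+ 2) *: y| ^+ 2 by exact: sqr_ge0.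
rewrite -inner_norm innerBl !innerBr !innerZl !innerZr !inner_norm (innerC y x).
set i := inner x y => h.
have {}h : i ^+ 2 <= `|x| ^+ 2 * `|y| ^+ 2.
  rewrite -ler_pdivrMr//; apply: le_trans (_ : i ^+ 2 / `|y| ^+ 2 <= _) _ => //.
  rewrite -subr_ge0; apply: le_trans h _; rewrite le_eqVlt; apply/orP; left.
  by apply/eqP; field; rewrite gt_eqF// normr_gt0.
rewrite -(@ler_pXn2r _ 2)// ?nnegrE ?mulr_ge0//.
by rewrite exprMn real_normK// num_real.
Qed.

Lemma continuous_inner y : continuous (inner ^~ y : H -> R).
Proof.
move=> x; apply/cvgrPdist_le => e e0.
have y0 : 0 < `|y| + 1 by rewrite ltr_wpDl.
near=> z; rewrite -innerBl; apply: (le_trans (inner_cauchy_schwarz _ _)).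
apply: (@le_trans _ _ (e / (`|y| + 1) * (`|y| + 1))); last by rewrite divfK// gt_eqF.
apply: ler_pM => //; last by rewrite lerDl.
near: z; apply: cvgr_dist_le; first exact: cvg_id.
by rewrite divr_gt0.
Unshelve. all: by end_near. Qed.

Lemma continuous_borel_measurable (f : H -> R) :
  continuous f -> measurable_fun (setT : set (borel H)) f.
Proof.
move=> /continuousP cf; apply: (measurability _ (RGenOpens.measurableE R)).
move=> _ [_ [a [b ->] <-]]; rewrite setTI; apply: sub_sigma_algebra.
exact/cf/interval_open.
Qed.

Lemma measurable_inner y : measurable_fun (setT : set (borel H)) (inner ^~ y : H -> R).
Proof.
apply: (continuous_borel_measurable (f := inner ^~ y : H -> R)).
exact: continuous_inner.
Qed.

Definition inner_functionals : set (borel H -> R) :=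
  [set f | exists y, f = inner ^~ y].

(** The norm as a supremum of linear functionals, restricted to a dense set. With D countable, a
    closed ball becomes a countable intersection of half-spaces. *)
Lemma inner_le_dense (D : set H) (w : H) (r : R) : dense D -> 0 <= r ->
  (forall y, D y -> inner w y <= r * `|y|) -> `|w| <= r.
Proof.
move=> dD r0 wr; rewrite leNgt; apply/negP => rw.
have w0 : 0 < `|w| by exact: le_lt_trans rw.
have rw0 : 0 < r + `|w| by rewrite ltr_wpDl.
(* Testing with a point within e of w costs at most e (r + |w|), which this choice makes half of the
   gap |w| (|w| - r). *)
pose e := `|w| * (`|w| - r) / (2 * (r + `|w|)).
have e0 : 0 < e by rewrite divr_gt0 ?mulr_gt0 ?subr_gt0.
have [|y [/= yb Dy]] := dD (ball w e) _ (ball_open w e).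
  by exists w; exact: ballxx.
have ywe : `|w - y| < e by move: yb; rewrite -ball_normE.
have h1 := wr y Dy.
have h2 : inner w (w - y) <= `|w| * e.
  apply: le_trans (ler_norm _) _; apply: le_trans (inner_cauchy_schwarz _ _) _.
  by rewrite ler_wpM2l// ltW.
have h3 : `|y| <= `|w| + e.
  have -> : y = w - (w - y) by rewrite opprB addrCA subrr addr0.
  by apply: le_trans (ler_normB _ _) _; rewrite lerD2l ltW.
have h4 : r * `|y| <= r * (`|w| + e) by rewrite ler_wpM2l.
have h5 : `|w| ^+ 2 <= r * `|w| + e * (r + `|w|).
  by move: h2; rewrite innerBr inner_norm; lra.
have h6 : e * (r + `|w|) = `|w| * (`|w| - r) / 2.
  by rewrite /e; field; rewrite gt_eqF.
have : 0 < `|w| * (`|w| - r) by rewrite mulr_gt0 ?subr_gt0.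
by move: h5; rewrite h6; lra.
Qed.

(** An open set is a countable union of closed balls [cb n k] about the points of a sequence that
    covers the dense set, and each ball is a countable intersection of half-spaces. *)
Lemma borel_inner_functionals : separable H ->
  @measurable _ (borel H) `<=` <<s functional_sets inner_functionals >>.
Proof.
move=> [D [/pcard_surjP[g gD] dD]]; apply: smallest_sub.
  exact: smallest_sigma_algebra.
move=> U oU.
pose S := g_sigma_algebraType (functional_sets inner_functionals).
pose cb (n k : nat) : set S := [set z | `|z - g n| <= k.+1%:R^-1].
have gDy y : D y -> exists n, g n = y by move=> /gD[n _ <-]; exists n.
have mcb n k : measurable (cb n k).
  have -> : cb n k = \bigcap_i [set z : S |
      D (g i) -> inner z (g i) <= k.+1%:R^-1 * `|g i| + inner (g n) (g i)].
    apply/seteqP; split => z /=.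
      move=> zk i _ /= _; rewrite -lerBlDr -innerBl.
      apply: le_trans (ler_norm _) _; apply: le_trans (inner_cauchy_schwarz _ _) _.
      by rewrite ler_wpM2r.
    move=> h; apply: (inner_le_dense dD) => // y Dy; have [i giy] := gDy y Dy.
    by rewrite innerBl lerBlDr -giy; apply: (h i) => //; rewrite giy.
  apply: bigcapT_measurable => i; have [Dgi|Dgi] := pselect (D (g i)); last first.
    rewrite (_ : [set _ | _] = setT)//.
    by apply/seteqP; split => // z _ /=.
  rewrite (_ : [set _ | _] = (inner ^~ (g i) : S -> R) @^-1`
      `]-oo, k.+1%:R^-1 * `|g i| + inner (g n) (g i)]).
    apply: sub_sigma_algebra; exists (inner ^~ (g i)); split; first by exists (g i).
    by exists `]-oo, k.+1%:R^-1 * `|g i| + inner (g n) (g i)]%classic.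
  by apply/seteqP; split => z /=; rewrite in_itv/=; [apply|].
rewrite (_ : U = \bigcup_n \bigcup_(k in [set k | cb n k `<=` U]) cb n k).
  suff : @measurable _ S (\bigcup_n \bigcup_(k in [set k | cb n k `<=` U]) cb n k).
    by [].
  by apply: bigcupT_measurable => n; exact: bigcup_measurable.
apply/seteqP; split => [z Uz|z [n _ [k /= cU /cU]]//].
have /nbhs_ballP[e /= e0 zeU] := open_nbhs_nbhs (conj oU Uz).
pose k := Num.truncn (2 / e).
have ke : 2 * k.+1%:R^-1 < e.
  rewrite ltr_pdivrMr// mulrC -ltr_pdivrMr//; exact: truncnS_gt.
have k0 : 0 < k.+1%:R^-1 :> R by rewrite invr_gt0.
have [|y [/= yb Dy]] := dD (ball z k.+1%:R^-1) _ (ball_open z _).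
  by exists z; exact: ballxx.
have [n gny] := gDy y Dy; exists n => //.
have zy : `|z - y| < k.+1%:R^-1 by move: yb; rewrite -ball_normE.
exists k; last by rewrite /cb /= gny ltW.
move=> w; rewrite /cb /= gny => wy; apply: zeU; rewrite -ball_normE /=.
have -> : z - w = (z - y) - (w - y) by rewrite opprB addrA subrK.
apply: le_lt_trans (ler_normB _ _) _; apply: lt_trans ke.
by rewrite mulr_natl mulr2n; exact: ltr_leD.
Qed.

End inner_product.

(** * Hilbert-valued Gaussian noise *)

Section hilbert_noise.
Context {R : realType} {Y : hilbertType R} (Ups : {linear Y -> Y}).

(** If <Ups v, v> vanished for all v, the trace would be 0; so some v gives a nondegenerate
    coordinate V = <., v>, and u = Ups v / <Ups v, v> is the direction sought, by symmetry of Ups.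
    Both y and k are chosen before gamma and sigma, which makes the final constant depend on Ups
    alone. *)
Lemma hilbert_noise_shift :
  separable Y -> trace1_covariance Ups ->
  exists y : Y, `|y| = 1 /\ exists2 k : R, 0 < k &
    forall (gamma : probability (borel Y) R) (sigma : R),
    hilbert_noise Ups gamma -> 0 < sigma ->
    shift_property gamma (fun s e => observe_hilbert sigma (s *: y) e)
      (k / sigma ^+ 2).
Proof.
move=> sepY [_ Usym Upos [N [e [eb tr1]]]].
have [v qv] : exists v, 0 < inner (Ups v) v.
  apply: contrapT => /forallNP no.
  have z i : inner (Ups (e i)) (e i) = 0.
    by apply/eqP; rewrite eq_le Upos andbT leNgt; apply/negP; exact: no.
  move: tr1; rewrite (_ : (fun i => _) = (fun=> 0%E)); last first.
    by apply/funext => i; rewrite z.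
  by rewrite esum1// => /eqP; rewrite eq_sym onee_eq0.
set q := inner (Ups v) v in qv.
have Uv0 : Ups v != 0.
  by apply/eqP => E; move: qv; rewrite /q E inner0l ltxx.
have nUv : 0 < `|Ups v| by rewrite normr_gt0.
pose M := fine (@normal_moment2 R).
have M0 : 0 <= M.
  by apply: fine_ge0; apply: integral_ge0 => x _; rewrite lee_fin sqr_ge0.
exists (`|Ups v|^-1 *: Ups v); split.
  by rewrite normrZ gtr0_norm ?invr_gt0// mulVf// gt_eqF.
(* The exact constant is q M / |Ups v|^2. Since M > 0 is known only in the presence of a noise law,
   1 is added to ensure positivity. *)
exists (q * M / `|Ups v| ^+ 2 + 1).
  by rewrite ltr_wpDl// divr_ge0 ?sqr_ge0// mulr_ge0// ltW.
move=> gamma sigma [gG gC] s0.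
pose V : borel Y -> R := inner ^~ v.
have moment2 z : (\int[gamma]_x ((inner (x : Y) z ^+ 2)%R)%:E = (inner (Ups z) z)%:E)%E.
  have [s zs] := centered_gaussianP (gG z).
  by rewrite (gaussian_law_moment2 zs) -(gaussian_law_variance zs) gC.
have [sV VsV] := centered_gaussianP (gG v).
have sVM : sV ^+ 2 * M = q.
  have := gaussian_law_moment2 VsV; rewrite moment2 -/q /M.
  have : (0 <= @normal_moment2 R)%E.
    by apply: integral_ge0 => x _; rewrite lee_fin sqr_ge0.
  case: normal_moment2 => [M' _ /= [] //|_|//].
  have [->|sV0] := eqVneq sV 0.
    by rewrite expr0n/= mul0e => -[] E; move: qv; rewrite E ltxx.
  by rewrite gt0_muley// lte_fin exprn_even_gt0.
have sV0 : sV != 0.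
  by apply/eqP => E; move: qv; rewrite -sVM E expr0n/= mul0r ltxx.
pose Phi (e : borel Y) (a : R) : borel Y := (e : Y) + a *: (q^-1 *: Ups v).
have mG (f : borel Y -> R) : inner_functionals f -> measurable_fun setT f.
  by move=> [y ->]; exact: measurable_inner.
have GZ (k : R) (f : borel Y -> R) : inner_functionals f -> inner_functionals (fun x => k * f x).
  by move=> [y ->]; exists (k *: y); apply/funext => x; rewrite innerZr.
pose Theta (e : borel Y) : borel Y := sigma *: (e : Y).
apply: (@shift_property_le _ _ _ _ _ ((q / (sigma * `|Ups v|)) ^+ 2 / sV ^+ 2)).
  have -> : (q / (sigma * `|Ups v|)) ^+ 2 / sV ^+ 2 = q * M / `|Ups v| ^+ 2 / sigma ^+ 2.
    rewrite -[X in (X / _) ^+ 2]sVM -[in RHS]sVM.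
    by field; rewrite sV0 !gt_eqF.
  by rewrite ler_wpM2r ?invr_ge0 ?sqr_ge0// lerDl.
apply: (@gaussian_shift_property _ _ _ gamma inner_functionals _ _ _ GZ
  (borel_inner_functionals sepY) V Phi q _ qv _ _ _ sV VsV Theta
  (fun s e => observe_hilbert sigma (s *: (`|Ups v|^-1 *: Ups v)) e)
  (q / (sigma * `|Ups v|)) _ _).
- by move=> f [y ->]; exact: gG.
- by exists 0; apply/funext => x; rewrite inner0r.
- by move=> f g [y ->] [z ->]; exists (y + z); apply/funext => x; rewrite innerDr.
- by exists v.
- exact: moment2.
- by move=> x a b; rewrite /Phi -addrA -scalerDl.
- move=> f [z ->].
  pose c := q^-1 * inner (Ups v) z.
  exists c, (inner (Ups z) z), (inner (Ups (z - c *: v)) (z - c *: v)); split.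
  + by move=> x a; rewrite /Phi innerDl !innerZl /c; ring.
  + exact: moment2.
  + rewrite -moment2; apply: eq_integral => x _.
    by rewrite innerBr innerZr.
  + rewrite linearB linearZ/= innerBl !innerBr !innerZl !innerZr -/q.
    have -> : inner (Ups z) v = inner (Ups v) z by rewrite Usym innerC.
    by rewrite /c; field; rewrite gt_eqF.
- apply: (measurable_functionals mG (borel_inner_functionals sepY)) => f [y ->].
  have -> : (inner ^~ y : borel Y -> R) \o Theta = (fun x => sigma * inner (x : Y) y).
    by apply/funext => x /=; rewrite innerZl.
  by apply: measurable_funM => //; exact: measurable_inner.
- move=> s x; rewrite /observe_hilbert /Theta /Phi scalerDr !scalerA addrC.
  by congr (_ + _ *: _); field; rewrite !gt_eqF.
Qed.

End hilbert_noise.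

(** * Gaussian white noise *)

Section white_noise.
Context {R : realType} {Y : hilbertType R}.

(** A realization w is linear only almost surely for each given combination, so the evaluations
    alone are not closed under sums as functions. Formal combinations are, and each agrees almost
    surely with one evaluation. *)
Definition coordinate_sum (s : seq (R * Y)) (w : process R Y) : R :=
  \sum_(p <- s) p.1 * w p.2.

Definition coordinate_functionals : set (process R Y -> R) :=
  range coordinate_sum.

Definition coordinate_vec (s : seq (R * Y)) : Y := \sum_(p <- s) p.1 *: p.2.

Lemma process_coordinate_functionals :
  @measurable _ (process R Y) `<=` <<s functional_sets coordinate_functionals >>.
Proof.
apply: smallest_sub; first exact: smallest_sigma_algebra.
move=> _ [y [B mB ->]]; apply: sub_sigma_algebra.
exists (coordinate_sum [:: (1, y)]); split; first by exists [:: (1, y)].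
exists B => //; rewrite (_ : coordinate_sum _ = fun w => w y)//.
by apply/funext => w; rewrite /coordinate_sum big_seq1 mul1r.
Qed.

Lemma measurable_process_coordinate (y : Y) :
  measurable_fun (setT : set (process R Y)) (fun w : Y -> R => w y).
Proof.
move=> _ B mB; rewrite setTI; apply: sub_sigma_algebra.
by exists y; exists B.
Qed.

Variable gamma : probability (process R Y) R.
Hypothesis gammaW : white_noise gamma.

Let ae_filter : Filter (nbhs (almost_everywhere gamma)).
Proof. exact: ae_filter_ringOfSetsType. Qed.

Lemma white_noise_coordinate_sum (s : seq (R * Y)) :
  {ae gamma, forall w : Y -> R, coordinate_sum s w = w (coordinate_vec s)}.
Proof.
have aef := ae_filter; elim: s => [|p s IH].
  have := white_linear gammaW 1 0 0; apply: filterS => w.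
  rewrite scaler0 addr0 mul1r /coordinate_sum /coordinate_vec !big_nil => h.
  by apply: (addrI (w 0)); rewrite addr0.
have := white_linear gammaW p.1 p.2 (coordinate_vec s).
apply: filterS2 IH => w h1 h2.
by rewrite /coordinate_sum /coordinate_vec !big_cons h2 -h1.
Qed.

Lemma coordinate_functional_gaussian f :
  coordinate_functionals f -> centered_gaussian gamma f.
Proof.
move=> [s _ <-].
have := white_gaussian gammaW (fun i : 'I_(size s) => (tnth (in_tuple s) i).1)
  (fun i : 'I_(size s) => (tnth (in_tuple s) i).2).
rewrite (_ : coordinate_sum s = fun w : Y -> R => \sum_(i < size s)
  (tnth (in_tuple s) i).1 * w (tnth (in_tuple s) i).2)//.
by apply/funext => w; rewrite /coordinate_sum big_tnth.
Qed.

Lemma coordinate_sum_moment2 (s : seq (R * Y)) :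
  (\int[gamma]_w ((coordinate_sum s w ^+ 2)%R)%:E =
   ((`|coordinate_vec s| ^+ 2)%R)%:E)%E.
Proof.
have aef := ae_filter; have [ms _] : centered_gaussian gamma (coordinate_sum s).
  by apply: coordinate_functional_gaussian; exists s.
rewrite -inner_norm -(white_covariance gammaW) unlock.
apply: ae_eq_integral => //.
- by apply/measurable_EFinP; exact: measurable_funX.
- apply/measurable_EFinP; apply: measurable_funM;
  exact: measurable_process_coordinate.
- have := white_noise_coordinate_sum s; apply: filterS => w -> _.
  by rewrite expr2.
Qed.

(** The coordinate w y has variance 1 and covariance <z, y> with w z, so the shift adds a <y, z> to
    w z. The variance 1 leaves a constant independent of Y and y. *)
Lemma white_noise_shift (y : Y) (sigma : R) : `|y| = 1 -> 0 < sigma ->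
  shift_property gamma (fun s w => observe_white sigma (s *: y) w)
    ((fine (@normal_moment2 R) + 1) / sigma ^+ 2).
Proof.
move=> y1 s0.
have VE : (fun w : process R Y => w y) = coordinate_sum [:: (1, y)].
  by apply/funext => w; rewrite /coordinate_sum big_seq1 mul1r.
have qV : (\int[gamma]_w (((w : process R Y) y ^+ 2)%R)%:E = 1%:E)%E.
  have := coordinate_sum_moment2 [:: (1, y)].
  by rewrite -VE /coordinate_vec big_seq1 scale1r y1 expr1n.
have [sV VsV] : exists sV, gaussian_law gamma (fun w : process R Y => w y) sV.
  apply: centered_gaussianP; apply: coordinate_functional_gaussian.
  by rewrite VE; exists [:: (1, y)].
have sVM : sV ^+ 2 * fine (@normal_moment2 R) = 1.
  have := gaussian_law_moment2 VsV; rewrite qV.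
  have : (0 <= @normal_moment2 R)%E.
    by apply: integral_ge0 => x _; rewrite lee_fin sqr_ge0.
  case: normal_moment2 => [M' _ /= [] //|_|//].
  have [->|sV0] := eqVneq sV 0.
    by rewrite expr0n/= mul0e => -[] /eqP; rewrite oner_eq0.
  by rewrite gt0_muley// lte_fin exprn_even_gt0.
have sV0 : sV != 0.
  by apply/eqP => E; move: sVM => /eqP; rewrite E expr0n/= mul0r eq_sym oner_eq0.
have MsV : fine (@normal_moment2 R) = sV ^- 2.
  by apply: (mulfI (expf_neq0 2 sV0)); rewrite sVM mulfV// expf_neq0.
pose Phi (w : process R Y) (a : R) : process R Y := fun z => w z + a * inner y z.
pose Theta (w : process R Y) : process R Y := fun z => sigma * w z.
have mG (f : process R Y -> R) : coordinate_functionals f -> measurable_fun setT f.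
  by move=> /coordinate_functional_gaussian[].
have GZ (k : R) (f : process R Y -> R) : coordinate_functionals f ->
    coordinate_functionals (fun x => k * f x).
  move=> [s _ <-]; exists [seq (k * p.1, p.2) | p <- s] => //.
  apply/funext => w; rewrite /coordinate_sum big_map mulr_sumr.
  by apply: eq_bigr => p _; rewrite mulrA.
have GD (f g : process R Y -> R) : coordinate_functionals f ->
    coordinate_functionals g -> coordinate_functionals (fun x => f x + g x).
  move=> [s _ <-] [t _ <-]; exists (s ++ t) => //.
  by apply/funext => w; rewrite /coordinate_sum big_cat.
apply: (@shift_property_le _ _ _ _ _ (sigma^-1 ^+ 2 / sV ^+ 2)).
  by rewrite MsV mulrC exprVn ler_wpM2r ?invr_ge0 ?sqr_ge0// lerDl.
apply: (@gaussian_shift_property _ _ _ gamma coordinate_functionals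
  coordinate_functional_gaussian _ GD GZ
  process_coordinate_functionals (fun w => w y) Phi 1 _ ltr01 qV _ _ sV VsV Theta
  (fun s w => observe_white sigma (s *: y) w) sigma^-1 _ _).
- by exists [::] => //; apply/funext => w; rewrite /coordinate_sum big_nil.
- by rewrite VE; exists [:: (1, y)].
- by move=> w a b; apply/funext => z; rewrite /Phi mulrDl addrA.
- move=> f [s _ <-]; pose z := coordinate_vec s; pose c := inner y z.
  exists c, (`|z| ^+ 2), (`|z - c *: y| ^+ 2); split.
  + move=> w a; rewrite /coordinate_sum /c /z /coordinate_vec.
    rewrite (@big_morph _ _ (inner y) 0 +%R 0 +%R (innerDr y) (inner0r y)).
    rewrite mulr_suml -big_split; apply: eq_bigr => p _ /=.
    by rewrite /Phi innerZr; ring.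
  + exact: coordinate_sum_moment2.
  + have := coordinate_sum_moment2 ((- c, y) :: s).
    have -> : coordinate_vec ((- c, y) :: s) = z - c *: y.
      by rewrite /coordinate_vec big_cons /= scaleNr addrC.
    move=> <-; apply: eq_integral => w _.
    by rewrite /coordinate_sum big_cons /= mulNr addrC.
  + rewrite -!inner_norm innerBl !innerBr !innerZl !innerZr inner_norm.
    by rewrite (inner_norm y) y1 (innerC z y) -/c; ring.
- apply: (measurable_functionals mG process_coordinate_functionals).
  move=> f [s _ <-].
  have -> : coordinate_sum s \o Theta = (fun w => sigma * coordinate_sum s w).
    apply/funext => w; rewrite /= /coordinate_sum mulr_sumr.
    by apply: eq_bigr => p _; rewrite mulrCA.
  by apply: measurable_funM => //; apply: mG; exists s.
- move=> s w; apply/funext => z; rewrite /observe_white /Theta /Phi innerZl.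
  by field; rewrite gt_eqF.
Qed.

End white_noise.

(** * Assouad's lemma *)

Section argmin.
Context d (S : measurableType d) {R : realType} (U : finType).
Variables (L : U -> S -> \bar R) (u0 : U).
Hypothesis mL : forall u, measurable_fun setT (L u).

Let cmp (x : S) : {ffun U * U -> bool} := [ffun p => (L p.1 x <= L p.2 x)%E].

Let best (v : {ffun U * U -> bool}) : U :=
  odflt u0 [pick u | [forall u', v (u, u')]].

Let measurable_cmp v : measurable [set x | cmp x = v].
Proof.
have -> : [set x | cmp x = v] =
    \bigcap_(p in [set: U * U]) ((fun x => (L p.1 x <= L p.2 x)%E) @^-1` [set v p]).
  apply/seteqP; split => x /=; first by move=> <- p _ /=; rewrite ffunE.
  by move=> h; apply/ffunP => p; rewrite ffunE; exact: h.
apply: fin_bigcap_measurable; first exact: finite_finset.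
move=> p _; rewrite -[X in measurable X]setTI.
by apply: measurable_fun_lee.
Qed.

(** The choice of a minimizer is measurable because it depends only on the finite table [cmp x] of
    comparisons, each value of which is a measurable event. The default [u0] serves tables without a
    minimum, which no x produces. *)
Lemma measurable_argmin : exists est : S -> U,
  (forall u, measurable [set x | est x = u]) /\
  (forall x u, (L (est x) x <= L u x)%E).
Proof.
exists (best \o cmp); split => [u|x u].
  have -> : [set x | (best \o cmp) x = u] =
      \bigcup_(v in [set v | best v = u]) [set x | cmp x = v].
    apply/seteqP; split => x /=; first by move=> h; exists (cmp x).
    by move=> [v /= <- <-].
  by apply: fin_bigcup_measurable => //; exact: finite_finset.
rewrite /= /best; case: pickP => [w /forallP/(_ u)|/=]; first by rewrite ffunE.
case: (Order.TotalTheory.arg_minP (P := xpredT) (fun w => L w x) (i0 := u0)) => // w _ hw.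
move=> /(_ w)/negbT/negP; case; apply/forallP => u'.
by rewrite ffunE/=; exact: hw.
Qed.

End argmin.

Section assouad.
Context d (T : measurableType d) {R : realType} (gamma : probability T R).
Variables (O : R -> T -> T) (kap : R).
Hypothesis OP : shift_property gamma O kap.
Hypothesis kap0 : 0 <= kap.
Variables (m : nat).

Let obs_measurable (s : 'I_m -> R) : measurable_fun setT (observe_tuple O s).
Proof. by apply: measurable_observe_tuple => t; exact: shift_property_measurable OP. Qed.

Let pr (s : 'I_m -> R) (A : set (m.-tuple T)) : R :=
  fine (iid_law gamma m (observe_tuple O s @^-1` A)).

Let mpre (s : 'I_m -> R) (A : set (m.-tuple T)) : measurable A ->
  measurable (observe_tuple O s @^-1` A).
Proof. by move=> mA; rewrite -[X in measurable X]setTI; exact: obs_measurable. Qed.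

Let prE (s : 'I_m -> R) (A : set (m.-tuple T)) : measurable A ->
  (pr s A)%:E = iid_law gamma m (observe_tuple O s @^-1` A).
Proof. by move=> mA; rewrite /pr fineK// fin_num_measure//; exact: mpre. Qed.

Let pr_integral (s : 'I_m -> R) (A : set (m.-tuple T)) : measurable A ->
  (pr s A)%:E = (\int[iid_law gamma m]_e (\1_A (observe_tuple O s e))%:E)%E.
Proof.
move=> mA; rewrite prE//.
rewrite (_ : (fun e => _) = (fun e => (\1_(observe_tuple O s @^-1` A) e)%:E))//.
by rewrite integral_indic ?setIT//; exact: mpre.
Qed.

Let pr01 (s : 'I_m -> R) (A : set (m.-tuple T)) : measurable A -> 0 <= pr s A <= 1.
Proof.
move=> mA; rewrite -!lee_fin prE// measure_ge0/=.
by apply: probability_le1; exact: mpre.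
Qed.

Let prC (s : 'I_m -> R) (A : set (m.-tuple T)) : measurable A -> pr s (~` A) = 1 - pr s A.
Proof.
move=> mA; apply: EFin_inj; rewrite EFinB !prE//; last exact: measurableC.
by rewrite preimage_setC probability_setC//; exact: mpre.
Qed.

(** Let al and be be the probabilities of A under s and s'. The indicator of A as test function
    gives be >= e^-x al^2, so the total error is at least e^-x (1 - al + al^2) >= 3/4 e^-x >= 3/4 (1
    - x). *)
Lemma two_point_error (s s' : 'I_m -> R) (A : set (m.-tuple T)) : measurable A ->
  3 / 4 * (1 - kap * \sum_i (s i - s' i) ^+ 2) <= pr s (~` A) + pr s' A.
Proof.
move=> mA; rewrite prC//.
have /andP[a0 a1] := pr01 s mA; have /andP[b0 b1] := pr01 s' mA.
set x := kap * _.
have mI : measurable_fun [set: m.-tuple T] (fun t => (\1_A t)%:E : \bar R).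
  by apply/measurable_EFinP; exact: measurable_indic.
have I0 t : (0 <= (\1_A t)%:E :> \bar R)%E by rewrite lee_fin.
have := shift_property_tensor s s' OP mI I0.
rewrite -pr_integral// -/x.
rewrite (eq_integral (fun e => (\1_A (observe_tuple O s' e))%:E)); last first.
  by move=> e _; rewrite -EFinM -expr2 indicE; case: (_ \in _); rewrite ?expr1n ?expr0n.
rewrite -pr_integral// -!EFinM lee_fin => h.
set al := pr s A in a0 a1 h *; set be := pr s' A in b0 b1 h *.
have e0 : 0 < expR (- x) by exact: expR_gt0.
have hb : expR (- x) * al ^+ 2 <= be.
  rewrite -(ler_pM2l (expR_gt0 x)) mulrA -expRD subrr expR0 mul1r expr2.
  exact: h.
have ex : 1 - x <= expR (- x) by exact: expR_ge1Dx.
have h34 : 3 / 4 <= 1 - al + al ^+ 2.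
  rewrite -subr_ge0 (_ : _ - _ = (al - 2^-1) ^+ 2) ?sqr_ge0//.
  by field.
have e1 : expR (- x) <= 1.
  rewrite -[leRHS]expR0 ler_expR oppr_le0 mulr_ge0// sumr_ge0// => i _.
  exact: sqr_ge0.
apply: (@le_trans _ _ (expR (- x) * (1 - al + al ^+ 2))).
  apply: (@le_trans _ _ (expR (- x) * (3 / 4))); last by rewrite ler_pM2l.
  by rewrite mulrC ler_pM2r//; lra.
rewrite mulrDr; apply: lerD => //.
by rewrite -[leRHS]mul1r; apply: ler_wpM2r => //; rewrite subr_ge0.
Qed.

Variable I : finType.

Definition flip (k : I) (th : {ffun I -> bool}) : {ffun I -> bool} :=
  [ffun j => if j == k then ~~ th j else th j].

Lemma flipK k : involutive (flip k).
Proof.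
by move=> th; apply/ffunP => j; rewrite !ffunE; case: eqP => // _; rewrite negbK.
Qed.

Definition hamming (th th' : {ffun I -> bool}) : R :=
  \sum_k (th k != th' k)%:R.

Variables (s : {ffun I -> bool} -> 'I_m -> R) (D : I -> R).
Hypothesis sD : forall th k, \sum_i (s th i - s (flip k th) i) ^+ 2 <= D k.
Hypothesis DI : kap * \sum_k D k <= #|I|%:R / 3.
Variables (loss : {ffun I -> bool} -> m.-tuple T -> \bar R) (Delta : R).
Hypothesis mloss : forall th, measurable_fun setT (loss th).
Hypothesis loss0 : forall th t, (0 <= loss th t)%E.
Hypothesis Delta0 : 0 <= Delta.
Hypothesis separation : forall th th' t,
  ((Delta * hamming th th')%:E <= loss th t + loss th' t)%E.

(** Let [est] be a pattern of least loss. By separation, twice the loss at the true pattern is at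
    least Delta times its Hamming distance to [est]. The risk thus splits over the coordinates k,
    each being a test between a pattern and its flip at k. *)
Lemma assouad :
  ((2 ^+ #|I| * (Delta * #|I|%:R / 8))%:E <=
   \sum_th \int[iid_law gamma m]_e loss th (observe_tuple O (s th) e))%E.
Proof.
have [est [mest estP]] := measurable_argmin [ffun=> false] mloss.
pose A k b := [set t | est t k = b].
have mA k b : measurable (A k b).
  have -> : A k b = \bigcup_(u in [set u : {ffun I -> bool} | u k = b]) [set t | est t = u].
    apply/seteqP; split => t /=; first by move=> h; exists (est t).
    by move=> [u /= ub eu]; rewrite /A /= eu.
  by apply: fin_bigcup_measurable => //; exact: finite_finset.
have ACE k b : ~` A k b = A k (~~ b).
  by apply/seteqP; split => t; rewrite /A /=; case: (est t k); case: b.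
have lossE th t : ((Delta / 2 * hamming th (est t))%:E <= loss th t)%E.
  have h : ((Delta * hamming th (est t))%:E <= loss th t + loss th t)%E.
    by apply: le_trans (separation th (est t) t) _; rewrite leeD2l.
  move: h (loss0 th t); case: (loss th t) => [r|_ _|//].
    by rewrite -EFinD !lee_fin => h _; lra.
  by rewrite leey.
have risk th : ((\sum_k Delta / 2 * pr (s th) (A k (~~ th k)))%:E <=
    \int[iid_law gamma m]_e loss th (observe_tuple O (s th) e))%E.
  have -> : ((\sum_k Delta / 2 * pr (s th) (A k (~~ th k)))%:E =
      \int[iid_law gamma m]_e
        (Delta / 2 * hamming th (est (observe_tuple O (s th) e)))%:E)%E.
    rewrite (eq_integral (fun e => (\sum_k (Delta / 2)%:E *
        (\1_(A k (~~ th k)) (observe_tuple O (s th) e))%:E)%E)); last first.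
      move=> e _; rewrite /hamming mulr_sumr -sumEFin; apply: eq_bigr => k _.
      rewrite EFinM indicE; congr (_ * (nat_of_bool _)%:R%:E)%E.
      apply/idP/idP; rewrite ?inE ?in_setE /A /=.
        by case: (th k); case: (est _ k).
      by move=> ->; case: (th k).
    have mIA k : measurable_fun setT (fun e =>
        (\1_(A k (~~ th k)) (observe_tuple O (s th) e))%:E : \bar R).
      apply/measurable_EFinP.
      by apply: (measurableT_comp (measurable_indic (mA _ _))); exact: obs_measurable.
    rewrite ge0_integral_sum//; last 2 first.
    - by move=> k; exact: measurable_funeM.
    - by move=> k e _; rewrite -EFinM lee_fin mulr_ge0// divr_ge0.
    rewrite -sumEFin; apply: eq_bigr => k _.
    rewrite ge0_integralZl//.
    + by rewrite -pr_integral.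
    + by rewrite lee_fin divr_ge0.
  apply: ge0_le_integral => //.
  - move=> e _; rewrite lee_fin mulr_ge0 ?divr_ge0// sumr_ge0//.
  - apply/measurable_EFinP; apply: measurable_funM => //.
    apply: measurable_sum => k.
    have -> : (fun e => (th k != est (observe_tuple O (s th) e) k)%:R) =
        (fun e => \1_(A k (~~ th k)) (observe_tuple O (s th) e)) :> (_ -> R).
      apply/funext => e; rewrite indicE; congr ((nat_of_bool _)%:R).
      apply/idP/idP; rewrite ?inE /A /=.
        by case: (th k); case: (est _ k).
      by move=> ->; case: (th k).
    by apply: (measurableT_comp (measurable_indic (mA _ _))); exact: obs_measurable.
  - by apply: (measurableT_comp (mloss th)); exact: obs_measurable.
apply: le_trans (lee_sum _ (fun th _ => risk th)).
rewrite sumEFin lee_fin exchange_big /=.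
under eq_bigr do rewrite -mulr_sumr.
rewrite -mulr_sumr.
have pair k : 2 ^+ #|I| * (3 / 4 * (1 - kap * D k)) <=
    2 * \sum_th pr (s th) (A k (~~ th k)).
  (* Reindexing by the flip at k counts the sum of errors twice, and so pairs every pattern with its
     neighbour. *)
  have E : \sum_th pr (s th) (A k (~~ th k)) =
      \sum_th pr (s (flip k th)) (A k (th k)).
    rewrite (reindex_inj (inv_inj (flipK k))) /=.
    by apply: eq_bigr => th _; rewrite ffunE eqxx negbK.
  apply: (@le_trans _ _ (\sum_th pr (s th) (A k (~~ th k)) +
    \sum_th pr (s (flip k th)) (A k (th k)))); last by rewrite -E; lra.
  rewrite -big_split /=.
  have -> : 2 ^+ #|I| = #|{ffun I -> bool}|%:R :> R.
    by rewrite card_ffun card_bool natrX.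
  have sumc (c : R) : \sum_(th : {ffun I -> bool}) c = c *+ #|{ffun I -> bool}|.
    by rewrite sumr_const.
  rewrite (mulr_natl _ #|{ffun I -> bool}|) -sumc; apply: ler_sum => th _.
  have := two_point_error (s th) (s (flip k th)) (mA k (th k)).
  rewrite ACE; apply: le_trans.
  by rewrite ler_wpM2l// lerD2l lerN2 ler_wpM2l.
(* By [DI] the total information removes at most a third of the coordinates: 1/2 * 3/8 * (1 - 1/3) =
   1/8. *)
apply: (@le_trans _ _ (Delta / 2 * \sum_k (2 ^+ #|I| * (3 / 8 * (1 - kap * D k))))).
  rewrite -mulr_sumr -mulr_sumr sumrB sumr_const -mulr_sumr.
  have p0 : 0 <= 2 ^+ #|I| :> R by rewrite exprn_ge0.
  have -> : 1 *+ #|I| = #|I|%:R :> R by [].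
  have := DI; set n := #|I|%:R; set x := kap * _ => xn.
  have -> : Delta / 2 * (2 ^+ #|I| * (3 / 8 * (n - x))) =
    2 ^+ #|I| * (Delta * (3 / 16 * (n - x))) by field.
  by rewrite ler_wpM2l// -mulrA ler_wpM2l//; lra.
rewrite ler_wpM2l ?divr_ge0//; apply: ler_sum => k _.
have -> : 2 ^+ #|I| * (3 / 8 * (1 - kap * D k)) =
  2^-1 * (2 ^+ #|I| * (3 / 4 * (1 - kap * D k))) by field.
by rewrite -ler_pdivlMl ?invr_gt0// invrK.
Qed.

End assouad.

(** * Maps into the Hilbert space and the L^p loss *)

Section borel_maps.
Context {R : realType} {X Y : hilbertType R}.
Hypothesis sepY : separable Y.

Lemma inner_functionals_measurable (f : borel Y -> R) :
  inner_functionals f -> measurable_fun setT f.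
Proof. by move=> [y ->]; exact: measurable_inner. Qed.

Lemma measurable_borelP d (S : measurableType d) (F : S -> borel Y) :
  measurable_fun setT F <->
  forall y : Y, measurable_fun setT (fun s => inner (F s : Y) y).
Proof.
split=> [mF y|mF]; first exact: (measurableT_comp (measurable_inner y)).
apply: (measurable_functionals inner_functionals_measurable
  (borel_inner_functionals sepY)) => f [y ->]; exact: mF.
Qed.

Lemma measurable_borelB d (S : measurableType d) (F G : S -> borel Y) :
  measurable_fun setT F -> measurable_fun setT G ->
  measurable_fun setT (fun s => (F s : Y) - (G s : Y) : borel Y).
Proof.
move=> /measurable_borelP mF /measurable_borelP mG; apply/measurable_borelP => y.
by under eq_fun do rewrite innerBl; exact: measurable_funB.
Qed.

Lemma measurable_borel_norm d (S : measurableType d) (F : S -> borel Y) :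
  measurable_fun setT F -> measurable_fun setT (fun s => `|F s : Y|).
Proof.
move=> mF; apply: (@measurableT_comp _ _ _ _ _ _ (fun y : borel Y => `|y : Y|)) => //.
apply: (continuous_borel_measurable (f := fun y : Y => `|y|)).
exact: norm_continuous.
Qed.

Lemma continuous_borel (F : X -> Y) : continuous F ->
  measurable_fun (setT : set (borel X)) (F : borel X -> borel Y).
Proof.
move=> /continuousP cF; apply: (@measurability _ _ (borel X) (borel Y) setT F (@open Y)) => //.
move=> _ [U oU <-]; rewrite setTI; apply: sub_sigma_algebra; exact: cF.
Qed.

End borel_maps.

Lemma lipschitz_continuous (R : realType) (X Y : normedModType R) (F : X -> Y) (L : R) :
  (forall x x', `|F x - F x'| <= L * `|x - x'|) -> continuous F.
Proof.
move=> FL x; apply/cvgrPdist_le => e e0.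
have L0 : 0 < `|L| + 1 by rewrite ltr_wpDl.
near=> z; apply: (le_trans (FL _ _)).
apply: (@le_trans _ _ ((`|L| + 1) * (e / (`|L| + 1)))); last first.
  by rewrite mulrC divfK// gt_eqF.
apply: (@le_trans _ _ ((`|L| + 1) * `|x - z|)).
  by rewrite ler_wpM2r// (le_trans (ler_norm _))// lerDl.
apply: ler_wpM2l; first exact: ltW.
near: z; apply: cvgr_dist_le; first exact: cvg_id.
by rewrite divr_gt0.
Unshelve. all: by end_near. Qed.

Section Lp.
Context {R : realType} {X Y : hilbertType R}.
Hypothesis sepY : separable Y.
Variables (mu : probability (borel X) R) (p : R).
Hypothesis p1 : 1 <= p.

Let p0 : 0 < p. Proof. exact: lt_le_trans p1. Qed.

Local Notation measurable_map F :=
  (measurable_fun (setT : set (borel X)) (F : borel X -> borel Y)).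

Let mdist (F G : X -> Y) : measurable_map F -> measurable_map G ->
  measurable_fun (setT : set (borel X)) (fun x => `|F x - G x|).
Proof.
move=> mF mG; apply: (measurable_borel_norm (F := fun x : borel X => F x - G x : borel Y)).
exact: measurable_borelB.
Qed.

Lemma ge0_Lnorm_powR (f : borel X -> R) : (forall x, 0 <= f x) ->
  ('N[mu]_(p%:E)[EFin \o f] = (\int[mu]_x ((f x `^ p)%R)%:E) `^ p^-1)%E.
Proof.
move=> f0; rewrite unlock; congr poweR; apply: eq_integral => x _.
by rewrite gee0_abs ?lee_fin//= poweR_EFin.
Qed.

Lemma Lp_normE (F : X -> Y) :
  Lp_norm mu p F = ((\int[mu]_x ((`|F x| `^ p)%R)%:E) `^ p^-1)%E.
Proof. exact: (ge0_Lnorm_powR (f := fun x => `|F x|)). Qed.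

Lemma Lp_norm_distC (F G : X -> Y) :
  Lp_norm mu p (fun x => F x - G x) = Lp_norm mu p (fun x => G x - F x).
Proof. by rewrite /Lp_norm; apply: eq_Lnorm => x; rewrite distrC. Qed.

Lemma Lp_norm_triangle (F G H : X -> Y) :
  measurable_map F -> measurable_map G -> measurable_map H ->
  (Lp_norm mu p (fun x => (F x - H x)%R) <=
   Lp_norm mu p (fun x => (F x - G x)%R) + Lp_norm mu p (fun x => (G x - H x)%R))%E.
Proof.
move=> mF mG mH.
have := minkowski_EFin mu (mdist mF mG) (mdist mG mH) p1.
apply: le_trans; rewrite Lp_normE ge0_Lnorm_powR; last first.
  by move=> x; rewrite addr_ge0.
have mpow (f : borel X -> R) : measurable_fun setT f ->
    measurable_fun setT (fun x => ((f x `^ p)%R)%:E).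
  by move=> mf; apply/measurable_EFinP; exact: (measurableT_comp (measurable_powR p) mf).
apply: gt0_ler_poweR.
- by rewrite invr_ge0 ltW.
- by rewrite in_itv/= leey andbT integral_ge0// => x _; rewrite lee_fin powR_ge0.
- by rewrite in_itv/= leey andbT integral_ge0// => x _; rewrite lee_fin powR_ge0.
apply: ge0_le_integral => //.
- exact: (mpow _ (mdist mF mH)).
- apply: (mpow (fun x => `|F x - G x| + `|G x - H x|)).
  exact: (measurable_funD (mdist mF mG) (mdist mG mH)).
- move=> x _; rewrite lee_fin.
  apply: ge0_ler_powR; rewrite ?nnegrE ?addr_ge0//; first exact: ltW.
  by rewrite (le_trans _ (ler_normD _ _))// addrA subrK.
Qed.

(** The sublevel sets of the loss are balls; their openness lets the measurability built into
    [estimator] yield that of the loss. *)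
Lemma Lp_open_ball (F : X -> Y) (r : R) : Lp_space mu p F ->
  Lp_open mu p [set G | (Lp_norm mu p (fun x => (F x - G x)%R) < r%:E)%E].
Proof.
move=> [mF _] G [mG _] /= FG.
have : (0 <= Lp_norm mu p (fun x => (F x - G x)%R))%E by exact: Lnorm_ge0.
move: FG; case E : (Lp_norm _ _ _) => [N| |]//; rewrite lte_fin => Nr _.
exists (r - N); first by rewrite subr_gt0.
move=> H [mH _] GH; apply: (le_lt_trans (Lp_norm_triangle mF mG mH)).
rewrite E Lp_norm_distC.
have -> : r%:E = (N%:E + (r - N)%:E)%E by rewrite -EFinD addrC subrK.
by rewrite lteD2lE.
Qed.

Lemma measurable_Lp_loss d (S : measurableType d) (F : X -> Y)
    (Fhat : S -> X -> Y) : Lp_space mu p F -> estimator mu p Fhat ->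
  measurable_fun setT (fun z => Lp_norm mu p (fun x => F x - Fhat z x)).
Proof.
move=> LF [_ mFhat]; apply: (measurability _ (ErealGenInftyO.measurableE R)).
move=> _ [_ [r ->] <-]; rewrite setTI.
have := mFhat _ (Lp_open_ball (r := r) LF).
congr (measurable _); apply/seteqP; split => z /=; by rewrite in_itv.
Qed.

Lemma Lp_space_bounded (F : X -> Y) (B : R) :
  continuous F -> (forall x, `|F x| <= B) -> Lp_space mu p F.
Proof.
move=> cF FB; have mF := continuous_borel cF; split => //.
rewrite Lp_normE poweR_lty//.
apply: (@le_lt_trans _ _ (\int[mu]_x ((B `^ p)%:E))%E); last first.
  rewrite integral_cst//; apply: (@le_lt_trans _ _ ((B `^ p)%:E * 1)%E).
    by rewrite lee_wpmul2l ?lee_fin ?powR_ge0//; exact: probability_le1.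
  by rewrite mule1 ltry.
have mnF := measurable_borel_norm mF.
apply: ge0_le_integral => //.
- by apply/measurable_EFinP; exact: (measurableT_comp (measurable_powR p) mnF).
- move=> x _; rewrite lee_fin; apply: ge0_ler_powR; rewrite ?nnegrE//.
    exact: ltW.
  exact: le_trans (FB x).
Qed.

Lemma Lp_norm_ge (F : X -> Y) (E : set (borel X)) (h q : R) :
  measurable_map F -> measurable E -> 0 <= h -> 0 <= q ->
  (forall x, E x -> h <= `|F x|) -> (q%:E <= mu E)%E ->
  ((h * q `^ p^-1)%:E <= Lp_norm mu p F)%E.
Proof.
move=> mF mE h0 q0 hF qE.
have -> : (h * q `^ p^-1)%:E = (((h `^ p * q)%R)%:E `^ p^-1)%E.
  rewrite poweR_EFin powRM ?powR_ge0// -powRrM mulfV ?gt_eqF//.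
  by rewrite powRr1.
rewrite Lp_normE; apply: gt0_ler_poweR.
- by rewrite invr_ge0 ltW.
- by rewrite in_itv/= leey andbT lee_fin mulr_ge0// powR_ge0.
- by rewrite in_itv/= leey andbT integral_ge0// => x _; rewrite lee_fin powR_ge0.
apply: (@le_trans _ _ (\int[mu]_x ((h `^ p)%:E * (\1_E x)%:E))%E).
  rewrite ge0_integralZl//; last 2 first.
  - by apply/measurable_EFinP; exact: measurable_indic.
  - by rewrite lee_fin powR_ge0.
  by rewrite integral_indic// setIT EFinM lee_wpmul2l// lee_fin powR_ge0.
have mnF := measurable_borel_norm mF.
apply: ge0_le_integral => //.
- by move=> x _; rewrite -EFinM lee_fin mulr_ge0// powR_ge0.
- by apply: measurable_funeM; apply/measurable_EFinP; exact: measurable_indic.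
- by apply/measurable_EFinP; exact: (measurableT_comp (measurable_powR p) mnF).
- move=> x _; rewrite -EFinM lee_fin indicE.
  have [/set_mem Ex|_] := boolP (x \in E); last by rewrite mulr0 powR_ge0.
  rewrite mulr1; apply: ge0_ler_powR; rewrite ?nnegrE//; first exact: ltW.
  exact: hF.
Qed.

End Lp.

(** * The hypercube of perturbations *)

Section disjoint_bumps.
Context {R : realType} {X : normedModType R} {I : finType}.
Variables (g : I -> X -> R) (h l : R).
Hypothesis g01 : forall k x, 0 <= g k x <= 1.
Hypothesis g_disjoint : forall k k' x, k != k' -> g k x = 0 \/ g k' x = 0.
Hypothesis l0 : 0 <= l.
Hypothesis g_lipschitz : forall k x x', g k x - g k x' <= l * `|x - x'|.
Hypothesis h0 : 0 <= h.

Let g_active x : (forall k, g k x = 0) \/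
  exists k0, forall k, k != k0 -> g k x = 0.
Proof.
have [[k0 gk0]|no] := pselect (exists k0, g k0 x != 0).
  right; exists k0 => k kk0; have [//|g0] := g_disjoint x kk0.
  by rewrite g0 eqxx in gk0.
left => k; apply: contrapT => gk; apply: no; exists k; exact/eqP.
Qed.

Lemma sum_active (f : I -> R) x (M : R) : 0 <= M ->
  (forall k, g k x = 0 -> f k = 0) -> (forall k, f k <= M) -> \sum_k f k <= M.
Proof.
move=> M0 f0 fM; have [g0|[k0 gk0]] := g_active x.
  by rewrite big1// => k _; exact: f0.
by rewrite (bigD1 k0)//= big1 ?addr0// => k /gk0; exact: f0.
Qed.

Lemma sum_bumps_le1 x : \sum_k g k x <= 1.
Proof. by apply: (@sum_active _ x) => // k; have /andP[] := g01 k x. Qed.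

(* At [x] only one of the positive parts of [g k x - g k x'] is nonzero, and
   symmetrically at [x'], hence the factor 2 instead of the number of bumps. *)
Lemma sum_bumps_lipschitz x x' : \sum_k `|g k x - g k x'| <= 2 * l * `|x - x'|.
Proof.
have half y y' : \sum_k Num.max (g k y - g k y') 0 <= l * `|y - y'|.
  apply: (@sum_active _ y); first by rewrite mulr_ge0.
    move=> k gk; have /andP[g0 _] := g01 k y'.
    by apply/max_idPr; rewrite gk sub0r oppr_le0.
  by move=> k; rewrite ge_max g_lipschitz mulr_ge0.
apply: (@le_trans _ _ (\sum_k (Num.max (g k x - g k x') 0 +
    Num.max (g k x' - g k x) 0))).
  apply: ler_sum => k _; rewrite ler_norml; apply/andP; split.
    have : g k x' - g k x <= Num.max (g k x' - g k x) 0 by rewrite le_max lexx.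
    have : 0 <= Num.max (g k x - g k x') 0 by rewrite le_max lexx orbT.
    by lra.
  by rewrite -[leLHS]addr0 lerD// le_max lexx ?orbT.
rewrite big_split /= (le_trans (lerD (half x x') (half x' x)))//.
by rewrite (distrC x') -mulrA mulr_natl mulr2n.
Qed.

Definition signal (th : {ffun I -> bool}) (x : X) : R :=
  \sum_k (-1) ^+ (th k) * (h * g k x).

Lemma signal_le th x : `|signal th x| <= h.
Proof.
apply: (le_trans (ler_norm_sum _ _ _)).
apply: (@sum_active _ x) => // k; rewrite normrM normrX normrN1 expr1n mul1r.
  by move=> ->; rewrite mulr0 normr0.
have /andP[gk0 gk1] := g01 k x.
by rewrite ger0_norm ?mulr_ge0// ler_piMr.
Qed.

Lemma signal_lipschitz th x x' :
  `|signal th x - signal th x'| <= 2 * h * l * `|x - x'|.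
Proof.
rewrite /signal -sumrB; apply: (le_trans (ler_norm_sum _ _ _)).
have -> : 2 * h * l * `|x - x'| = h * (2 * l * `|x - x'|) by ring.
apply: le_trans (ler_wpM2l h0 (sum_bumps_lipschitz x x')).
rewrite mulr_sumr; apply: ler_sum => k _.
by rewrite -mulrBr -mulrBr normrM normrX normrN1 expr1n mul1r normrM ger0_norm.
Qed.

Lemma signal_separated (th th' : {ffun I -> bool}) k x : th k != th' k -> 2^-1 <= g k x ->
  h <= `|signal th x - signal th' x|.
Proof.
move=> thk gk; have gk0 : g k x != 0 by rewrite gt_eqF// (lt_le_trans _ gk).
have E t : signal t x = (-1) ^+ (t k) * (h * g k x).
  rewrite /signal (bigD1 k)//= big1 ?addr0// => k' k'k.
  have [->|/eqP] := g_disjoint x k'k; first by rewrite !mulr0.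
  by rewrite (negbTE gk0).
have h2 : h <= 2 * (h * g k x) by rewrite mulrCA ler_peMr//; lra.
have s0 : 0 <= h * g k x by rewrite mulr_ge0// (le_trans _ gk).
rewrite !E; move: thk; case: (th k); case: (th' k) => //= _;
  rewrite ?expr1 ?expr0.
  by rewrite -normrN (le_trans h2)// (le_trans _ (ler_norm _))//; lra.
by rewrite (le_trans h2)// (le_trans _ (ler_norm _))//; lra.
Qed.

(** The factor g k x is kept instead of being bounded by 1: summed over k it gives at most 1, so a
    design point contributes at most 4 h^2 in all, however many bumps there are. *)
Lemma signal_flip (th : {ffun I -> bool}) k x :
  (signal th x - signal (flip k th) x) ^+ 2 <= 4 * h ^+ 2 * g k x.
Proof.
have -> : signal th x - signal (flip k th) x = (-1) ^+ (th k) * (2 * h * g k x).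
  rewrite /signal -sumrB (bigD1 k)//= big1 ?addr0.
    by rewrite ffunE eqxx; case: (th k); rewrite ?expr1 ?expr0 /=; ring.
  by move=> j jk; rewrite ffunE (negbTE jk) subrr.
rewrite exprMn sqrr_sign mul1r exprMn.
have /andP[gk0 gk1] := g01 k x.
have -> : (2 * h) ^+ 2 = 4 * h ^+ 2 by ring.
by rewrite ler_wpM2l ?mulr_ge0 ?sqr_ge0// expr2 ler_piMr.
Qed.

End disjoint_bumps.

(** * The grid in Karhunen-Loeve coordinates *)

Section grid.
Context {R : realType} {X : hilbertType R}.
Variables (p a b : R) (N : option nat) (lam : nat -> R) (phi : nat -> X).
Variables (mu : probability (borel X) R) (d n : nat).
Hypothesis p1 : 1 <= p.
Hypothesis muP : design_measure p a b N lam phi mu.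
Hypothesis dN : le_dim d N.
Hypothesis n0 : (0 < n)%N.

Local Notation cell := {ffun 'I_d -> 'I_n}.
Local Notation xi := (kl_coord lam phi).

Let a0 : 0 < a. Proof. by case: muP. Qed.
Let b0 : 0 < b. Proof. by case: muP. Qed.

Let in_d i : (i < d)%N -> in_dim N i.
Proof. by move: dN; rewrite /le_dim /in_dim; case: N => // N' dN' /leq_trans; apply. Qed.

Let lam0 i : (i < d)%N -> 0 < lam i.
Proof. by move=> /in_d; case: muP => _ _ + *; exact. Qed.

Definition cell_radius : R := a / n%:R.
Local Notation r := cell_radius.

Let r0 : 0 < r. Proof. by rewrite divr_gt0 ?ltr0n. Qed.

Definition cell_center (k : cell) (j : 'I_d) : R := - a + (2 * (k j)%:R + 1) * r.

Definition cell_dist (k : cell) (x : X) : R :=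
  \big[Num.max/0]_(j < d) `|xi j x - cell_center k j|.

Definition bump (k : cell) (x : X) : R := Num.max 0 (1 - cell_dist k x / r).

(** The coordinate has Lipschitz constant 1 / sqrt (lambda_j), a single term under the root; this is
    where the sum of the 1 / lambda_j enters the rate. *)
Let kl_coord_lipschitz (j : 'I_d) x x' :
  `|xi j x - xi j x'| <= Num.sqrt (sum_inv lam d) * `|x - x'|.
Proof.
have lj : 0 < lam j by exact: lam0.
rewrite /kl_coord -mulrBl -innerBl normrM.
have phi1 : `|phi j| = 1.
  have := basis_orthonormal (design_basis muP) (in_d (ltn_ord j)) (in_d (ltn_ord j)).
  rewrite inner_norm eqxx => /eqP; rewrite sqrf_eq1 => /orP[/eqP//|/eqP E].
  by have := normr_ge0 (phi j); rewrite E oppr_ge0 ler10.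
rewrite mulrC ler_pM//; last by rewrite -[leRHS]mulr1 -phi1 inner_cauchy_schwarz.
rewrite ger0_norm ?invr_ge0// -sqrtrV ?(ltW lj)//; apply: ler_wsqrtr.
rewrite /sum_inv big_mkord.
rewrite (bigD1 j)//= lerDl; apply: sumr_ge0 => i _.
by rewrite invr_ge0 ltW// lam0.
Qed.

Lemma cell_dist_lipschitz k x x' :
  cell_dist k x <= cell_dist k x' + Num.sqrt (sum_inv lam d) * `|x - x'|.
Proof.
apply/bigmax_leP; split.
  by rewrite addr_ge0 ?mulr_ge0// /cell_dist; exact: bigmax_ge_id.
move=> j _; have -> : xi j x - cell_center k j =
  (xi j x' - cell_center k j) + (xi j x - xi j x') by ring.
apply: (le_trans (ler_normD _ _)); apply: lerD => //.
by rewrite /cell_dist; exact: le_bigmax.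
Qed.

Lemma bump_itv k x : 0 <= bump k x <= 1.
Proof.
rewrite /bump le_max lexx ge_max ler01 lerBlDr lerDl divr_ge0 ?(ltW r0)//.
exact: bigmax_ge_id.
Qed.

Lemma bump_lipschitz k x x' :
  bump k x - bump k x' <= Num.sqrt (sum_inv lam d) / r * `|x - x'|.
Proof.
have e0 : 0 <= Num.sqrt (sum_inv lam d) / r * `|x - x'|.
  by rewrite mulr_ge0// divr_ge0// ltW.
rewrite lerBlDr {1}/bump ge_max; apply/andP; split.
  by rewrite addr_ge0//; have /andP[] := bump_itv k x'.
apply: (@le_trans _ _ (Num.sqrt (sum_inv lam d) / r * `|x - x'| +
    (1 - cell_dist k x' / r))); last by rewrite lerD2l /bump le_max lexx orbT.
have : cell_dist k x' / r <=
    cell_dist k x / r + Num.sqrt (sum_inv lam d) / r * `|x - x'|.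
  rewrite ler_pdivrMr// mulrDl divfK ?gt_eqF// mulrAC divfK ?gt_eqF// distrC.
  exact: cell_dist_lipschitz.
by lra.
Qed.

Lemma bump_disjoint k k' x : k != k' -> bump k x = 0 \/ bump k' x = 0.
Proof.
move=> kk'; have [j kj] : exists j, k j != k' j.
  apply: contrapT => /forallNP E; case/negP: kk'; apply/eqP/ffunP => j.
  by apply/eqP; apply: contrapT => /negP; exact: E.
have zero q : bump q x != 0 -> `|xi j x - cell_center q j| < r.
  move=> bq; have : cell_dist q x / r < 1.
    rewrite ltNge; apply: contra bq => ge1; apply/eqP/max_idPl.
    by rewrite subr_le0.
  rewrite ltr_pdivrMr// mul1r; apply: le_lt_trans.
  by rewrite /cell_dist; exact: le_bigmax.
have [->|bk] := eqVneq (bump k x) 0; first by left.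
have [->|bk'] := eqVneq (bump k' x) 0; first by right.
have := zero _ bk; have := zero _ bk'; rewrite /cell_center.
have sep (i i' : 'I_n) : (i < i')%N -> (2 * i%:R + 1) * r + 2 * r <= (2 * i'%:R + 1) * r.
  move=> ii'; rewrite -mulrDl ler_pM2r//.
  have : (i.+1)%:R <= i'%:R :> R by rewrite ler_nat.
  by rewrite -natr1; lra.
rewrite !ltr_norml => /andP[h1 h2] /andP[h3 h4].
have : (k j < k' j)%N \/ (k' j < k j)%N.
  by apply/orP; rewrite -neq_ltn.
by case=> /sep h5; lra.
Qed.

(** Since p + 1 >= 2, this radius keeps the bump at least 1/2; as a fraction of r it becomes the
    denominator p + 1 of the rate. *)
Definition core (k : cell) : set (borel X) :=
  [set x | forall j : 'I_d, `|xi j x - cell_center k j| <= r / (p + 1)].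

Lemma bump_core k x : core k x -> 2^-1 <= bump k x.
Proof.
move=> kx; rewrite /bump le_max; apply/orP; right.
have : cell_dist k x <= r / (p + 1).
  apply/bigmax_leP; split => [|j _]; last exact: kx.
  by rewrite divr_ge0// ?ltW//; have := p1; lra.
move=> h; have h1 : cell_dist k x / r <= (p + 1)^-1.
  by rewrite ler_pdivrMr// mulrC.
have h2 : (p + 1)^-1 <= 2^-1 by rewrite lef_pV2 ?posrE//; have := p1; lra.
by lra.
Qed.

Lemma measurable_kl_coord j : measurable_fun (setT : set (borel X)) (xi j).
Proof. by apply: measurable_funM => //; exact: measurable_inner. Qed.

Lemma measurable_core k : measurable (core k).
Proof.
have -> : core k = \bigcap_(j in [set: 'I_d])
    (xi j : borel X -> R) @^-1` [set t | `|t - cell_center k j| <= r / (p + 1)].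
  by apply/seteqP; split => x h j; [move=> _; exact: (h j)|exact: (h j)].
apply: fin_bigcap_measurable; first exact: finite_finset.
move=> j _; rewrite -[X in measurable X]setTI; apply: measurable_kl_coord => //.
have -> : [set t : R | `|t - cell_center k j| <= r / (p + 1)] =
    [set` `[cell_center k j - r / (p + 1), cell_center k j + r / (p + 1)]].
  by apply/seteqP; split => t /=; rewrite in_itv/= ler_distl.
exact: measurable_itv.
Qed.

Let itv_around (c e : R) : set R := [set` `[c - e, c + e]].

Let kl_coord_interval (j : 'I_d) (c e : R) : 0 <= e -> `|c| + e <= a ->
  ((2 * b * e)%:E <= mu (xi j @^-1` itv_around c e))%E.
Proof.
move=> e0 ce; have [nu [mnu nu0 nuE] nub] := design_density muP (in_d (ltn_ord j)).
rewrite nuE; last exact: measurable_itv.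
apply: (@le_trans _ _ (\int[lebesgue_measure]_(x in itv_around c e) b%:E)%E).
  rewrite integral_cst; last exact: measurable_itv.
  rewrite /= /itv_around lebesgue_measure_itv/= lte_fin.
  case: ifPn => [_|]; first by rewrite -EFinB -EFinM lee_fin; lra.
  rewrite -leNgt mule0 lee_fin => ce'.
  have -> : e = 0 by lra.
  by rewrite mulr0.
apply: ge0_le_integral => //.
- exact: measurable_itv.
- by move=> x _; rewrite lee_fin ltW.
- by apply/measurable_EFinP; exact: measurable_funTS.
- move=> x; rewrite /itv_around /= in_itv/= lee_fin => /andP[x1 x2]; apply: nub.
  move: ce; rewrite ler_norml => ce; apply/andP; split.
    by have := ler_norm (- c); rewrite normrN; lra.
  by have := ler_norm c; lra.
Qed.

Let prod_ge (s : seq nat) (f : nat -> \bar R) (q : R) : 0 <= q ->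
  (forall i, i \in s -> (q%:E <= f i)%E) ->
  ((q ^+ size s)%:E <= \prod_(i <- s) f i)%E.
Proof.
move=> q0; elim: s => [|i s IH] qf; first by rewrite big_nil expr0.
rewrite big_cons exprS EFinM; apply: lee_pmul.
- by rewrite lee_fin.
- by rewrite lee_fin exprn_ge0.
- by apply: qf; rewrite inE eqxx.
- by apply: IH => j js; apply: qf; rewrite inE js orbT.
Qed.

Lemma measure_core k : (((2 * b * (r / (p + 1))) ^+ d)%:E <= mu (core k))%E.
Proof.
have p10 : 0 < p + 1 by have := p1; lra.
have e0 : 0 <= r / (p + 1) by rewrite divr_ge0// ltW.
pose J : {fset nat} := [fset i in iota 0 d]%fset.
have inJ i : (i \in J) = (i < d)%N by rewrite !inE/= mem_iota.
(* The events in [independent] are indexed by all of nat; beyond d the default is the whole line. *)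
pose A i : set R := if insub i is Some j then
  itv_around (cell_center k j) (r / (p + 1))
  else setT.
have AE (j : 'I_d) : A j =
    itv_around (cell_center k j) (r / (p + 1)).
  by rewrite /A valK.
have mA i : measurable (A i).
  by rewrite /A; case: insub => // j; exact: measurable_itv.
have JD : [set` J] `<=` [set i | in_dim N i].
  by move=> i /=; rewrite inJ; exact: in_d.
have coreE : core k = \bigcap_(i in [set` J]) (xi i @^-1` A i).
  apply/seteqP; split => [x h i|x h j].
    rewrite /= inJ => id; have -> : i = Ordinal id by [].
    by rewrite AE /itv_around /= in_itv/= -ler_distl; exact: (h (Ordinal id)).
  have := h j; rewrite /= inJ => /(_ (ltn_ord j)).
  by rewrite AE /itv_around /= in_itv/= -ler_distl.
have sizeJ : size (enum_fset J) = d.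
  rewrite -[RHS](size_iota 0); apply/perm_size/uniq_perm => [||i].
  - exact: fset_uniq.
  - exact: iota_uniq.
  - by rewrite [LHS]inJ mem_iota.
rewrite coreE (design_independent muP JD mA).
have := @prod_ge (enum_fset J) (fun i => mu (xi i @^-1` A i)) (2 * b * (r / (p + 1))).
rewrite sizeJ; apply; first by rewrite mulr_ge0// mulr_ge0// ltW.
move=> i; rewrite inJ => id; have -> : i = Ordinal id by [].
rewrite AE; apply: kl_coord_interval => //.
(* The interval stays in [-a, a], where the density is at least b: its centre is within a - r of 0
   and its half-width is at most r. *)
have rp : r / (p + 1) <= r by rewrite ler_pdivrMr// ler_peMr ?(ltW r0)//; have := p1; lra.
have rn : r * n%:R = a by rewrite /r divfK// pnatr_eq0 -lt0n.
apply: (@le_trans _ _ (`|cell_center k (Ordinal id)| + r)); first by rewrite lerD2l.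
have kn : ((k (Ordinal id)).+1%:R : R) <= n%:R by rewrite ler_nat.
have k0 : 0 <= ((k (Ordinal id))%:R : R) by [].
have h1 : (k (Ordinal id)).+1%:R * r <= n%:R * r by rewrite ler_wpM2r// ltW.
have h2 : 0 <= (k (Ordinal id))%:R * r by rewrite mulr_ge0// ltW.
have := h1; rewrite -natr1 mulrDl mul1r [n%:R * r]mulrC rn => h3.
have r0' := r0.
rewrite -lerBrDr ler_norml /cell_center mulrDl mul1r -mulrA.
by apply/andP; split; lra.
Qed.

End grid.

(** * The minimax lower bound *)

Lemma le_ereal_sup_average (R : realType) (U : finType) (A : Type) (D : set A)
    (F : U -> A) (risk : A -> \bar R) (q : R) : (0 < #|U|)%N ->
  (forall u, D (F u)) -> (forall u, (0 <= risk (F u))%E) ->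
  ((#|U|%:R * q)%:E <= \sum_u risk (F u))%E ->
  (q%:E <= ereal_sup [set risk f | f in D])%E.
Proof.
move=> U0 DF risk0 qle; set M := ereal_sup _.
have riskM u : (risk (F u) <= M)%E.
  by apply: ereal_sup_ubound; exists (F u).
have M0 : (0 <= M)%E.
  by have /card_gt0P[u _] := U0; exact: le_trans (riskM u).
move: M0 riskM; case: M => [M _ riskM|_ _|//]; last by rewrite leey.
rewrite lee_fin -(@ler_pM2l _ #|U|%:R) ?ltr0n// -lee_fin.
apply: (le_trans qle); apply: (@le_trans _ _ (\sum_(u : U) M%:E)%E).
  exact: lee_sum.
by rewrite sumEFin lee_fin sumr_const mulr_natl.
Qed.

Section lower_bound.
Context {R : realType} {X Y : hilbertType R}.
Hypothesis sepY : separable Y.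
Variables (p a b : R) (N : option nat) (lam : nat -> R) (phi : nat -> X).
Variables (mu : probability (borel X) R) (d n : nat).
Hypothesis p1 : 1 <= p.
Hypothesis muP : design_measure p a b N lam phi mu.
Hypothesis dN : le_dim d N.
Hypothesis n0 : (0 < n)%N.
Variable y : Y.
Hypothesis y1 : `|y| = 1.
Context (dT : measure_display) (T : measurableType dT).
Variables (gamma : probability T R) (obs : Y -> T -> T) (kap : R).
Hypothesis kap0 : 0 <= kap.
Hypothesis obsP : shift_property gamma (fun s e => obs (s *: y) e) kap.
Variables (h : R) (m : nat).
Hypothesis h0 : 0 <= h.
Hypothesis information : kap * (4 * h ^+ 2 * m%:R) <= (n ^ d)%:R / 3.

Local Notation cell := {ffun 'I_d -> 'I_n}.
Local Notation g := (@bump R X a lam phi d n).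
Local Notation sg := (signal g h).

Let g01 k x : 0 <= g k x <= 1.
Proof. exact: (bump_itv muP n0). Qed.

Let g_disjoint k k' x : k != k' -> g k x = 0 \/ g k' x = 0.
Proof. exact: (bump_disjoint muP n0). Qed.

Let l : R := Num.sqrt (sum_inv lam d) / cell_radius a n.

Let l0 : 0 <= l.
Proof.
rewrite /l divr_ge0// /cell_radius divr_ge0//; apply: ltW.
by case: muP.
Qed.

Let g_lipschitz k x x' : g k x - g k x' <= l * `|x - x'|.
Proof. exact: (bump_lipschitz muP dN n0). Qed.

Definition signal_map (th : {ffun cell -> bool}) (x : X) : Y := sg th x *: y.

Let norm_signal_map c : `|c *: y| = `|c|.
Proof. by rewrite normrZ y1 mulr1. Qed.

Lemma signal_map_norm_le th x : `|sg th x| <= h.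
Proof. exact: (signal_le g01 g_disjoint h0). Qed.

Lemma signal_map_lipschitz th x x' :
  `|sg th x - sg th x'| <= 2 * h * l * `|x - x'|.
Proof. exact: (signal_lipschitz g01 g_disjoint l0 g_lipschitz h0). Qed.

Let signal_continuous (th : {ffun cell -> bool}) : continuous (sg th).
Proof. exact: (lipschitz_continuous (signal_map_lipschitz th)). Qed.

Let signal_map_continuous th : continuous (signal_map th).
Proof.
apply: (lipschitz_continuous (L := 2 * h * l)) => x x'.
by rewrite /signal_map -scalerBl norm_signal_map; exact: signal_map_lipschitz.
Qed.

Let signal_map_measurable th :
  measurable_fun (setT : set (borel X)) (signal_map th : borel X -> borel Y).
Proof. by apply: continuous_borel; exact: signal_map_continuous. Qed.

Lemma signal_map_Lp_space th : Lp_space mu p (signal_map th).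
Proof.
apply: (Lp_space_bounded mu p1 (B := h)); first exact: signal_map_continuous.
by move=> x; rewrite norm_signal_map; exact: signal_map_norm_le.
Qed.

Let cmass : R := (2 * b * (cell_radius a n / (p + 1))) ^+ d.

Let cmass0 : 0 <= cmass.
Proof.
have [_ _ _ _ _ _ _ a0 b0 _ _] := muP.
have r0 : 0 <= cell_radius a n by rewrite /cell_radius divr_ge0// ltW.
have q0 : 0 <= p + 1 by have := p1; lra.
by apply: exprn_ge0; apply: mulr_ge0; [rewrite mulr_ge0// ltW|exact: divr_ge0].
Qed.

Let card_cell : #|{: cell}| = (n ^ d)%N.
Proof. by rewrite card_ffun !card_ord. Qed.

Let K : R := #|{: cell}|%:R.

Let K0 : 0 < K.
Proof. by rewrite /K card_cell ltr0n expn_gt0 n0. Qed.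

Let Delta : R := h * (cmass * K) `^ p^-1 / K.

Let Delta0 : 0 <= Delta.
Proof. by rewrite divr_ge0 ?mulr_ge0 ?powR_ge0// ltW. Qed.

(** The patterns differ by at least h on the disjoint cores of the cells where they disagree, of
    total mass at least [cmass] times the Hamming distance H. This gives h (cmass H)^(1/p), which
    the next comparison makes linear in H. *)
Lemma signal_map_separation th th' :
  ((Delta * hamming th th')%:E <=
   Lp_norm mu p (fun x => (signal_map th x - signal_map th' x)%R))%E.
Proof.
pose P k := th k != th' k.
pose E := \bigcup_(k in [set` P]) @core R X p a lam phi d n k.
have mcore k : measurable (@core R X p a lam phi d n k) by exact: measurable_core.
have mE : measurable E.
  by apply: fin_bigcup_measurable => //; exact: finite_finset.
have q0 : 0 <= cmass * hamming (R := R) th th'.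
  by rewrite mulr_ge0// sumr_ge0.
have muE : ((cmass * hamming (R := R) th th')%:E <= mu E)%E.
  rewrite measure_fin_bigcup//; last first.
    move=> k k' _ _ [x [/(bump_core p1 muP n0) gk /(bump_core p1 muP n0) gk']].
    apply/eqP; apply: contrapT => /negP kk'.
    by have [E0|E0] := g_disjoint x kk'; [move: gk|move: gk'];
      rewrite E0 invr_le0 lern0.
  rewrite -(@bigfs _ _ _ _ (index_enum cell) P); last 2 first.
  - exact: index_enum_uniq.
  - by move=> k _; rewrite mem_index_enum.
  rewrite [leRHS]big_mkcond /hamming mulr_sumr -sumEFin; apply: lee_sum => k _.
  rewrite /P; case: (th k != th' k); last by rewrite mulr0.
  by rewrite mulr1; exact: (measure_core p1 muP dN n0).
have mF := signal_map_measurable.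
have := @Lp_norm_ge _ X Y mu p p1 (fun x => signal_map th x - signal_map th' x)
   E h _ (measurable_borelB sepY (mF th) (mF th')) mE h0 q0 _ muE.
move=> lp; apply: le_trans (lp _); last first.
  move=> x [k /= Pk kx]; rewrite /signal_map -scalerBl norm_signal_map.
  exact: (signal_separated g_disjoint h0 Pk (bump_core p1 muP n0 kx)).
(* As H / K <= 1 and p >= 1, (H / K)^(1/p) >= H / K; equality at H = K makes the resulting bound
   lossless for opposite patterns. *)
rewrite lee_fin /Delta -!mulrA ler_wpM2l//.
have H0 : 0 <= hamming (R := R) th th' by exact: sumr_ge0.
have HK : hamming (R := R) th th' <= K.
  rewrite /hamming /K -sumr_const; apply: ler_sum => k _.
  by case: (_ != _).
have [H00|Hn] := eqVneq (hamming (R := R) th th') 0.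
  by rewrite H00 !mulr0 powR_ge0.
have -> : cmass * hamming th th' = (cmass * K) * (hamming th th' / K).
  by rewrite -mulrA; congr (_ * _); rewrite mulrCA divff ?mulr1// gt_eqF.
have K0' := ltW K0.
rewrite [leRHS]powRM ?mulr_ge0 ?invr_ge0//.
have q01 : 0 < hamming (R := R) th th' / K <= 1.
  by apply/andP; split; [rewrite divr_gt0// lt0r Hn|rewrite ler_pdivrMr// mul1r].
rewrite ler_wpM2l ?powR_ge0// [leLHS]mulrC; apply: ger1_powR => //.
by rewrite invf_le1// (lt_le_trans ltr01).
Qed.

Let risk_bound : R := h * (cmass * K) `^ p^-1 / 8.

(** No design can be informative about many cells: the bumps sum to at most 1 at each of the m
    points, so the total information is at most [kap] times 4 h^2 m, wherever the points lie. *)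
Lemma bayes_risk_ge (xs : 'I_m -> X) (Ghat : m.-tuple T -> X -> Y) :
  estimator mu p Ghat ->
  ((2 ^+ #|{: cell}| * risk_bound)%:E <= \sum_th \int[iid_law gamma m]_e
     Lp_norm mu p (fun x => (signal_map th x -
       Ghat [tuple obs (signal_map th (xs i)) (tnth e i) | i < m] x)%R))%E.
Proof.
move=> GP; have [GL _] := GP.
pose loss th t := Lp_norm mu p (fun x => signal_map th x - Ghat t x).
have mF := signal_map_measurable.
have := @assouad _ T R gamma _ _ obsP kap0 m {: cell}
  (fun th i => sg th (xs i)) (fun k => \sum_i 4 * h ^+ 2 * g k (xs i)) _ _ loss Delta.
have -> : Delta * #|{: cell}|%:R / 8 = risk_bound.
  by rewrite /Delta /risk_bound -/K; field; rewrite gt_eqF.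
apply.
- move=> th k; apply: ler_sum => i _; exact: (signal_flip g01 h0).
- apply: le_trans (_ : kap * (4 * h ^+ 2 * m%:R) <= _); last first.
    by rewrite card_cell; exact: information.
  rewrite ler_wpM2l// exchange_big /=.
  have -> : 4 * h ^+ 2 * m%:R = \sum_(i < m) 4 * h ^+ 2 :> R.
    by rewrite sumr_const card_ord mulr_natr.
  apply: ler_sum => i _; rewrite -mulr_sumr -[leRHS]mulr1 ler_wpM2l//.
    by rewrite mulr_ge0// sqr_ge0.
  exact: (sum_bumps_le1 g01 g_disjoint).
- by move=> th; apply: measurable_Lp_loss => //; exact: signal_map_Lp_space.
- by move=> th t; exact: Lnorm_ge0.
- exact: Delta0.
- move=> th th' t; apply: (le_trans (signal_map_separation th th')).
  rewrite /loss (Lp_norm_distC mu p (signal_map th') (Ghat t)).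
  apply: Lp_norm_triangle => //; exact: (GL t).1.
Qed.

Variable Fcl : set (X -> Y).
Hypothesis signal_map_class : forall th, Fcl (signal_map th).

Let average (risk : (X -> Y) -> \bar R) :
  (forall th, (0 <= risk (signal_map th))%E) ->
  ((2 ^+ #|{: cell}| * risk_bound)%:E <= \sum_th risk (signal_map th))%E ->
  (risk_bound%:E <= ereal_sup [set risk F | F in Fcl])%E.
Proof.
move=> risk0 le; apply: (le_ereal_sup_average (F := signal_map)) => //.
  by rewrite card_ffun card_bool expn_gt0.
by rewrite card_ffun card_bool natrX.
Qed.

Lemma minimax_fixed_ge : (risk_bound%:E <= minimax_fixed mu p gamma obs m Fcl)%E.
Proof.
apply: le_ereal_inf_tmp => _ [xs _ <-]; apply: le_ereal_inf_tmp => _ [Fhat FhatP <-].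
apply: average; first by move=> th; apply: integral_ge0 => e _; exact: Lnorm_ge0.
exact: bayes_risk_ge.
Qed.

Lemma estimator_comp d1 d2 (S1 : measurableType d1) (S2 : measurableType d2)
    (f : S1 -> S2) (Fhat : S2 -> X -> Y) :
  measurable_fun setT f -> estimator mu p Fhat -> estimator mu p (Fhat \o f).
Proof.
move=> mf [FL mF]; split => [z|U oU]; first exact: FL.
by rewrite comp_preimage -[X in measurable X]setTI; apply: mf => //; exact: mF.
Qed.

(** Tonelli's theorem moves the sum over patterns inside the integral over designs, where the
    fixed-design bound holds for each realization. *)
Lemma minimax_random_ge : (risk_bound%:E <= minimax_random mu p gamma obs m Fcl)%E.
Proof.
apply: le_ereal_inf_tmp => _ [nu _ <-]; apply: le_ereal_inf_tmp => _ [Fhat FhatP <-].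
apply: (average (risk := fun F => \int[iid_law nu m \x iid_law gamma m]_z
  Lp_norm mu p (fun x => (F x - Fhat [tuple (tnth z.1 i,
    obs (F (tnth z.1 i)) (tnth z.2 i)) | i < m] x)%R))%E).
  by move=> th; apply: integral_ge0 => e _; exact: Lnorm_ge0.
pose data th (z : m.-tuple (borel X) * m.-tuple T) : m.-tuple (borel X * T) :=
  [tuple (tnth z.1 i, obs (signal_map th (tnth z.1 i)) (tnth z.2 i)) | i < m].
have mdata th : measurable_fun setT (data th).
  apply/measurable_fun_tnthP => i.
  have -> : (@tnth m (borel X * T))^~ i \o data th =
      (fun z => (tnth z.1 i, obs (signal_map th (tnth z.1 i)) (tnth z.2 i))).
    by apply/funext => z /=; rewrite tnth_mktuple.
  have m1 : measurable_fun setT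
      (fun z : m.-tuple (borel X) * m.-tuple T => tnth z.1 i).
    exact: (measurableT_comp (measurable_tnth i) measurable_fst).
  apply: measurable_fun_pair => //.
  (* The signal level now varies with the random design point, so joint measurability in signal and
     noise is used. *)
  have [mO _] := obsP.
  apply: (measurableT_comp mO
    (g := fun z : m.-tuple (borel X) * m.-tuple T => (sg th (tnth z.1 i), tnth z.2 i))).
  apply: measurable_fun_pair.
    exact: (measurableT_comp (continuous_borel_measurable (signal_continuous (th := th))) m1).
  exact: (measurableT_comp (measurable_tnth i) measurable_snd).
pose loss th z := Lp_norm mu p (fun x => signal_map th x - Fhat (data th z) x).
have mloss th : measurable_fun setT (loss th).
  apply: (measurableT_comp (measurable_Lp_loss sepY p1 (signal_map_Lp_space th) FhatP)).
  exact: mdata.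
have loss0 th z : (0 <= loss th z)%E by exact: Lnorm_ge0.
rewrite (eq_bigr (fun th => \int[iid_law nu m]_xs \int[iid_law gamma m]_e loss th (xs, e)))%E;
  last first.
  by move=> th _; exact: (@fubini_tonelli1 _ _ _ _ _ (iid_law nu m) (iid_law gamma m)
    (loss th) (mloss th) (loss0 th)).
have mint th : measurable_fun setT (fun xs => \int[iid_law gamma m]_e loss th (xs, e))%E.
  exact: (@measurable_fun_fubini_tonelli_F _ _ _ _ _ (iid_law gamma m)
    (loss th) (mloss th) (loss0 th)).
rewrite -ge0_integral_sum//; last by move=> th xs _; exact: integral_ge0.
apply: (@le_trans _ _ (\int[iid_law nu m]_xs (2 ^+ #|{: cell}| * risk_bound)%:E)%E).
  rewrite integral_cst// [X in (_ <= _ * X)%E](_ : _ = 1%E) ?mule1//.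
  exact: probability_setT.
apply: ge0_le_integral => //.
- move=> xs _; rewrite lee_fin mulr_ge0// /risk_bound divr_ge0// mulr_ge0//.
  exact: powR_ge0.
- by apply: emeasurable_sum => th; exact: mint.
(* Attaching the known points xs to the observations turns [Fhat] into an estimator for the fixed
   design xs. *)
- move=> xs _; pose zip t : m.-tuple (borel X * T) :=
    [tuple (tnth xs i, tnth t i) | i < m].
  have mzip : measurable_fun setT zip.
    apply/measurable_fun_tnthP => i.
    have -> : (@tnth m (borel X * T))^~ i \o zip = (fun t => (tnth xs i, tnth t i)).
      by apply/funext => t /=; rewrite tnth_mktuple.
    by apply: measurable_fun_pair => //; exact: measurable_tnth.
  have := bayes_risk_ge (fun i => tnth xs i) (estimator_comp mzip FhatP).
  congr (_ <= _)%E; apply: eq_bigr => th _; apply: eq_integral => e _.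
  rewrite /loss /=; congr (Lp_norm _ _ _); apply/funext => x; congr (_ - Fhat _ x).
  by apply: eq_from_tnth => i; rewrite !tnth_mktuple.
Qed.

End lower_bound.

(** With h = L r / (2 sqrt S) the Lipschitz constant is exactly L, and r <= a / 8 gives h <= B. The
    information is then kap m L^2 r^2 / (sigma^2 S), at most n^d / 3 = (a / r)^d / 3 as soon as r^(d
    + 2) <= 1 / Q, with c = 1 / (3 kap) in Q. Hence the minimum of a / 8 and Q^(-1 / (2 + d)). *)
Lemma lower_rate_grid (R : realType) (p a b L sigma B kap : R) (lam : nat -> R)
    (m d : nat) :
  1 <= p -> 0 < a -> 0 < b -> 0 < L -> 0 < sigma -> 0 < kap -> (0 < m)%N ->
  0 < sum_inv lam d -> a * L / (8 * Num.sqrt (sum_inv lam d)) <= B ->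
  exists n h, [/\ (0 < n)%N, 0 <= h <= B,
    2 * h * (Num.sqrt (sum_inv lam d) / cell_radius a n) <= L,
    kap / sigma ^+ 2 * (4 * h ^+ 2 * m%:R) <= (n ^ d)%:R / 3 &
    32^-1 * lower_rate (3 * kap)^-1 p L sigma a b lam m d <=
      h * ((2 * b * (cell_radius a n / (p + 1))) ^+ d * (n ^ d)%:R) `^ p^-1 / 8].
Proof.
move=> p1 a0 b0 L0 s0 k0 m0; set S := sum_inv lam d => S0 hB.
have rS0 : 0 < Num.sqrt S by rewrite sqrtr_gt0.
have rS2 : Num.sqrt S ^+ 2 = S by rewrite sqr_sqrtr// ltW.
have mR0 : 0 < m%:R :> R by rewrite ltr0n.
set Q := L ^+ 2 * m%:R / ((3 * kap)^-1 * a ^+ d * sigma ^+ 2 * S).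
have Q0 : 0 < Q by rewrite divr_gt0 ?mulr_gt0 ?exprn_gt0 ?invr_gt0 ?mulr_gt0.
set rho := Q `^ (- (2 + d%:R)^-1).
have rho0 : 0 < rho by exact: powR_gt0.
have rhoE : rho ^+ (2 + d) = Q^-1.
  have d2 : 2 + d%:R != 0 :> R by rewrite gt_eqF// ltr_wpDr.
  rewrite -(powR_mulrn _ (ltW rho0)) -powRrM natrD mulNr mulVf//.
  by rewrite powR_inv1// ltW.
pose r0 := Num.min (a / 8) rho.
have r00 : 0 < r0 by rewrite lt_min rho0 divr_gt0.
pose n := (Num.truncn (a / r0)).+1.
have nR0 : 0 < n%:R :> R by rewrite ltr0n.
pose r := cell_radius a n.
have rE : r = a / n%:R by [].
have r_gt0 : 0 < r by rewrite rE divr_gt0.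
have rr0 : r <= r0.
  by rewrite rE ler_pdivrMr// mulrC -ler_pdivrMr// ltW// truncnS_gt.
have r0a : r0 <= a / 8 by rewrite ge_min lexx.
have r0r : r0 / 2 <= r.
  rewrite rE ler_pdivlMr//.
  have h1 : n%:R <= a / r0 + 1.
    by rewrite /n -natr1 lerD2r truncn_le divr_ge0// ltW.
  have : r0 * n%:R <= r0 * (a / r0 + 1) by rewrite ler_pM2l.
  by rewrite mulrDr mulrCA divff ?gt_eqF// !mulr1; lra.
(* [r] lies between [r0 / 2] and [r0], the minimum in [lower_rate]. *)
exists n, (L * r / (2 * Num.sqrt S)); split => //.
- have h0 : 0 <= L * r / (2 * Num.sqrt S) by rewrite divr_ge0// mulr_ge0// ltW.
  rewrite h0 /=; apply: le_trans hB; rewrite [a * L]mulrC invfM invfM !mulrA ler_pM2r ?invr_gt0//.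
  rewrite -!mulrA ler_pM2l//; lra.
- by rewrite -/r le_eqVlt; apply/orP; left; apply/eqP; field; rewrite !gt_eqF.
- have hr : r ^+ (2 + d) <= Q^-1.
    rewrite -rhoE lerXn2r ?nnegrE ?(ltW r_gt0) ?(ltW rho0)//.
    by apply: (le_trans rr0); rewrite ge_min lexx orbT.
  have nr : (n ^ d)%:R = a ^+ d / r ^+ d.
    by rewrite natrX -expr_div_n rE; congr (_ ^+ d); field; rewrite !gt_eqF.
  rewrite nr; have rd0 : 0 < r ^+ d by rewrite exprn_gt0.
  rewrite ler_pdivlMr ?ltr0n// ler_pdivlMr//.
  move: hr; rewrite exprD -[Q^-1]mul1r ler_pdivlMr// => hr.
  have ad0 : 0 < a ^+ d by rewrite exprn_gt0.
  have {}hr := ler_wpM2l (ltW ad0) hr; rewrite mulr1 in hr.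
  apply: le_trans hr; rewrite le_eqVlt; apply/orP; left; apply/eqP.
  rewrite /Q; move: (Num.sqrt S) rS0 rS2 => s s_gt0 <-; field.
  by rewrite !gt_eqF.
- have p0 : 0 < p + 1 by lra.
  rewrite /lower_rate -/S -/Q -/rho -/r0.
  (* The number n^d of cells cancels the n in the cell radius: the bound on the total mass of the
     cores is independent of the resolution. *)
  have -> : (2 * b * (cell_radius a n / (p + 1))) ^+ d * (n ^ d)%:R =
      (2 * a * b / (p + 1)) ^+ d.
    rewrite natrX -exprMn -/r rE; congr (_ ^+ d); field.
    by rewrite !gt_eqF.
  have io0 : 0 <= 2 * a * b / (p + 1).
    by rewrite ltW// divr_gt0// !mulr_gt0.
  rewrite -powR_mulrn// -powRrM; set W := _ `^ _.
  have W0 : 0 <= W by exact: powR_ge0.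
  have -> : L * r / (2 * Num.sqrt S) * W / 8 = (L / Num.sqrt S * W) * (r / 16).
    by field; rewrite gt_eqF.
  rewrite mulrCA; apply: ler_wpM2l; last by lra.
  by rewrite mulr_ge0// divr_ge0// ltW.
Qed.

Lemma sum_inv_gt0 (R : realType) (lam : nat -> R) (d : nat) (N : option nat) :
  (forall i, in_dim N i -> 0 < lam i) -> (0 < d)%N -> le_dim d N ->
  0 < sum_inv lam d.
Proof.
move=> lam0 d0 dN.
have pos i : (i < d)%N -> 0 < (lam i)^-1.
  by move=> id; rewrite invr_gt0 lam0//; case: N dN {lam0} => //= ?; exact: leq_trans.
rewrite /sum_inv big_ltn//; apply: ltr_pwDl; first exact: pos.
by rewrite big_nat_cond sumr_ge0// => i /andP[/andP[_ /pos/ltW]].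
Qed.

(** The form common to both noise models: the noise enters through [shift_property] along y, and the
    class through the bounded Lipschitz maps with values on the line of y. *)
Lemma minimax_lower_rate (R : realType) (X Y : hilbertType R)
    (p a b : R) (N : option nat) (lam : nat -> R) (phi : nat -> X)
    (mu : probability (borel X) R) (y : Y) dT (T : measurableType dT)
    (gamma : probability T R) (obs : Y -> T -> T) (B L sigma kap : R)
    (m d : nat) (Fcl : set (X -> Y)) :
  separable Y -> 1 <= p -> 0 < L -> 0 < sigma -> (0 < m)%N ->
  design_measure p a b N lam phi mu -> (0 < d)%N -> le_dim d N ->
  a * L / (8 * Num.sqrt (sum_inv lam d)) <= B ->
  `|y| = 1 -> 0 < kap ->
  shift_property gamma (fun s e => obs (s *: y) e) (kap / sigma ^+ 2) ->
  (forall f : X -> R, (forall x, `|f x| <= B) ->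
     (forall x x', `|f x - f x'| <= L * `|x - x'|) -> Fcl (fun x => f x *: y)) ->
  ((32^-1 * lower_rate (3 * kap)^-1 p L sigma a b lam m d)%:E
     <= minimax_fixed mu p gamma obs m Fcl)%E /\
  ((32^-1 * lower_rate (3 * kap)^-1 p L sigma a b lam m d)%:E
     <= minimax_random mu p gamma obs m Fcl)%E.
Proof.
move=> sepY p1 L0 s0 m0 muP d0 dN hB y1 k0 obsP FclP.
have [_ _ lam0 _ _ _ _ a0 b0 _ _] := muP.
have S0 := sum_inv_gt0 lam0 d0 dN.
have [n [h [n0 /andP[h0 hle] hL info rate]]] :=
  lower_rate_grid p1 a0 b0 L0 s0 k0 m0 S0 hB.
have kap0 : 0 <= kap / sigma ^+ 2 by rewrite divr_ge0 ?sqr_ge0// ltW.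
have mapP th : Fcl (@signal_map R X Y a lam phi d n y h th).
  apply: FclP => [x|x x'].
    by apply: le_trans hle; exact: (signal_map_norm_le muP n0 h0).
  apply: (le_trans (signal_map_lipschitz muP dN n0 h0 th x x')).
  by rewrite ler_wpM2r.
have card : #|{: {ffun 'I_d -> 'I_n}}| = (n ^ d)%N.
  by rewrite card_ffun !card_ord.
rewrite -card in rate.
split; apply: (@le_trans _ _ (h * ((2 * b * (cell_radius a n / (p + 1))) ^+ d *
    #|{: {ffun 'I_d -> 'I_n}}|%:R) `^ p^-1 / 8)%:E) => //.
- exact: (minimax_fixed_ge sepY p1 muP dN n0 y1 kap0 obsP h0 info mapP).
- exact: (minimax_random_ge sepY p1 muP dN n0 y1 kap0 obsP h0 info mapP).
Qed.

Lemma orthonormal_basis_dim0 (R : realType) (Y : hilbertType R)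
    (NY : option nat) (psi : nat -> Y) :
  (exists y : Y, y != 0) -> orthonormal_basis NY psi -> in_dim NY 0.
Proof.
move=> [y y0] psiP; case: NY psiP => [[|//]|//] psiP.
have := @basis_expansion _ _ _ _ psiP y.
rewrite (_ : (fun n => _) = (fun=> 0)); last first.
  by apply/funext => n; rewrite big1// => i.
move=> /(cvg_unique (@norm_hausdorff _ _))/(_ (@cvg_cst _ _ _ _ _)) y00.
by rewrite y00 eqxx in y0.
Qed.

(** The basis vector of index 0 has weight 1, whatever t is. Perturbations along it therefore
    satisfy the smoothness constraint as soon as they are bounded by B. *)
Lemma smooth_norm_psi0 (R : realType) (Y : hilbertType R)
    (NY : option nat) (psi : nat -> Y) (t f : R) :
  in_dim NY 0 -> orthonormal_basis NY psi ->
  smooth_norm NY psi t (f *: psi 0%N) = `|f|%:E.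
Proof.
move=> N0 psiP; rewrite /smooth_norm.
rewrite (esumID [set 0%N]); last by move=> i _; rewrite lee_fin mulr_ge0 ?powR_ge0.
rewrite [X in (_ + X)%E]esum1 ?adde0; last first.
  move=> i [/= Ni /eqP i0]; rewrite innerZl (basis_orthonormal psiP)// eq_sym.
  by rewrite (negbTE i0) mulr0 normr0 expr0n mulr0.
rewrite (_ : _ `&` _ = [set 0%N]); last first.
  by apply/seteqP; split => [i []//|i /= ->].
rewrite esum_set1 ?lee_fin ?mulr_ge0 ?powR_ge0//.
rewrite innerZl (basis_orthonormal psiP)// eqxx mulr1 powR1 mul1r.
by rewrite poweR_EFin powR12_sqrt ?sqr_ge0// sqrtr_sqr normr_id.
Qed.

Theorem theorem3p1 (R : realType) :
  exists2 C : R, 0 < C &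
  (forall (Y : hilbertType R) (Ups : {linear Y -> Y}),
     separable Y -> (exists y : Y, y != 0) -> trace1_covariance Ups ->
     exists2 c : R, 0 < c &
     forall (X : hilbertType R) (p B L sigma a b : R) (m : nat)
       (N : option nat) (lam : nat -> R) (phi : nat -> X)
       (mu : probability (borel X) R) (gamma : probability (borel Y) R)
       (d : nat),
     separable X -> 1 <= p -> 0 < B -> 0 < L -> 0 < sigma -> (0 < m)%N ->
     design_measure p a b N lam phi mu ->
     hilbert_noise Ups gamma ->
     (0 < d)%N -> le_dim d N ->
     a * L / (8 * Num.sqrt (sum_inv lam d)) <= B ->
     ((C * lower_rate c p L sigma a b lam m d)%:E
        <= minimax_fixed mu p gamma (observe_hilbert sigma) m
             (class_BL B L))%E /\
     ((C * lower_rate c p L sigma a b lam m d)%:E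
        <= minimax_random mu p gamma (observe_hilbert sigma) m
             (class_BL B L))%E) /\
  (exists2 c : R, 0 < c &
     forall (X Y : hilbertType R) (p B L sigma a b t : R) (m : nat)
       (N : option nat) (lam : nat -> R) (phi : nat -> X)
       (NY : option nat) (psi : nat -> Y)
       (mu : probability (borel X) R) (gamma : probability (process R Y) R)
       (d : nat),
     separable X -> separable Y -> (exists y : Y, y != 0) ->
     1 <= p -> 0 < B -> 0 < L -> 0 < sigma -> 0 < t -> (0 < m)%N ->
     orthonormal_basis NY psi ->
     design_measure p a b N lam phi mu ->
     white_noise gamma ->
     (0 < d)%N -> le_dim d N ->
     a * L / (8 * Num.sqrt (sum_inv lam d)) <= B ->
     ((C * lower_rate c p L sigma a b lam m d)%:E
        <= minimax_fixed mu p gamma (@observe_white R Y sigma) m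
             (class_tBL NY psi t B L))%E /\
     ((C * lower_rate c p L sigma a b lam m d)%:E
        <= minimax_random mu p gamma (@observe_white R Y sigma) m
             (class_tBL NY psi t B L))%E).
Proof.
exists 32^-1; first by rewrite invr_gt0.
split.
- move=> Y Ups sepY _ trU.
  have [y [y1 [k k0 shiftP]]] := hilbert_noise_shift sepY trU.
  exists (3 * k)^-1; first by rewrite invr_gt0 mulr_gt0.
  move=> X p B L sigma a b m N lam phi mu gamma d _ p1 _ L0 s0 m0 muP noiseP d0 dN hB.
  apply: (minimax_lower_rate sepY p1 L0 s0 m0 muP d0 dN hB y1 k0).
    exact: shiftP.
  move=> f fB fL; split => [x|x x']; first by rewrite normrZ y1 mulr1.
  by rewrite -scalerBl normrZ y1 mulr1.
- have k0 : 0 < fine (@normal_moment2 R) + 1.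
    by rewrite ltr_wpDl// fine_ge0// integral_ge0// => x _; rewrite lee_fin sqr_ge0.
  exists (3 * (fine (@normal_moment2 R) + 1))^-1; first by rewrite invr_gt0 mulr_gt0.
  move=> X Y p B L sigma a b t m N lam phi NY psi mu gamma d _ sepY Y0 p1 _ L0 s0 _ m0.
  move=> psiP muP noiseP d0 dN hB.
  have N0 := orthonormal_basis_dim0 Y0 psiP.
  have y1 : `|psi 0%N| = 1.
    have /eqP := basis_orthonormal psiP N0 N0.
    by rewrite eqxx inner_norm sqrp_eq1 // => /eqP.
  apply: (minimax_lower_rate sepY p1 L0 s0 m0 muP d0 dN hB y1 k0).
    exact: white_noise_shift.
  move=> f fB fL; split => [x|x x'].
    by rewrite (smooth_norm_psi0 _ _ N0 psiP) lee_fin.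
  by rewrite -scalerBl normrZ y1 mulr1.
Qed.
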